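(* Let $m\in\{1,2,\ldots\}$ and $k_1,k_2,\ldots,k_m\in\{0,1,2,\ldots\}$, and let $\mathcal{P}_k(y)\equiv y^k$. For $x>0$, $\Gamma_a\mathcal{P}_{k_m}\Gamma_a\mathcal{P}_{k_{m-1}}\cdots\Gamma_a\mathcal{P}_{k_1}(x)$ is equal to $$(-\varrho)^{-m}\sum_{i_1=0}^{n_1}\binom{n_1}{i_1}\frac{(-1)^{i_1}\psi_{i_1}}{n_1-i_1+1}\;\sum_{i_2=0}^{n_2}\binom{n_2}{i_2}\frac{(-1)^{i_2}\psi_{i_2}}{n_2-i_2+1}\;\cdots\;\sum_{i_m=0}^{n_m}\binom{n_m}{i_m}\frac{(-1)^{i_m}\psi_{i_m}}{n_m-i_m+1}\;x^{\sum_{j=1}^m(k_j+1-i_j)},$$ where $n_1=k_1$ and, for $2\le r\le m$, $n_r=k_r+\sum_{j=1}^{r-1}(k_j+1-i_j)$ (so that $n_r-i_r+1=\sum_{j=1}^{r}(k_j+1-i_j)$).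
   Context: $J(\cdot)$ is a Lévy process (càdlàg, $J(0)=0$) that is the superposition of a subordinator and an independent drifted Brownian motion; its Laplace exponent is $$\varphi(\alpha)\equiv-\log\mathbb{E}e^{-\alpha J(1)}=c\alpha-\frac{\sigma^2\alpha^2}{2}-\int_{(0,\infty)}(e^{-\alpha y}-1)\,\nu(\mathrm{d}y),\qquad \alpha\ge0,$$ where $c\in\mathbb{R}$, $\sigma\ge0$ and $\nu$ is a Borel measure on $(0,\infty)$ with $\int_{(0,\infty)}(1\wedge y)\,\nu(\mathrm{d}y)<\infty$. Standing assumption: $\varrho\equiv\mathbb{E}J(1)=\varphi'(0+)=c+\int_{(0,\infty)}y\,\nu(\mathrm{d}y)$ is finite and negative. For $x\ge0$ let $W_x(t)=x+J(t)$ and $\tau_x=\inf\{t\ge0:W_x(t)=0\}$; for a Borel function $f:\mathbb{R}_+\to\mathbb{R}_+$, $A_f(x)=\int_0^{\tau_x}f(W_x(t))\,\mathrm{d}t$ and $\Gamma_af(x)\equiv\mathbb{E}A_f(x)$. Products and compositions: $g\Gamma_a f(x)\equiv g(x)\cdot\Gamma_a f(x)$, and $\Gamma_a f_1\Gamma_a f_2\equiv\Gamma_a(f_1\cdot\Gamma_a f_2)$ (not the product $(\Gamma_a f_1)(\Gamma_a f_2)$), and similarly, associating to the right, for longer strings. $\psi(\alpha)\equiv\alpha\varphi'(0+)/\varphi(\alpha)$ for $\alpha>0$, and $\psi_i\equiv\lim_{\alpha\downarrow0}\psi^{(i)}(\alpha)$ ($i$-th derivative; possibly infinite, with $\psi_0=1$).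 *)

(* Defs.v *)
From HB Require Import structures.
From mathcomp Require Import all_boot all_order all_algebra.
From mathcomp Require Import all_classical all_reals all_analysis.

Set Implicit Arguments.
Unset Strict Implicit.
Unset Printing Implicit Defensive.

Import Order.TTheory GRing.Theory Num.Theory.
Import numFieldNormedType.Exports.

Local Open Scope classical_set_scope.
Local Open Scope ring_scope.

(* MathComp-Analysis. A process is a family X : R -> {RV P >-> R}; only the
   times t >= 0 are ever constrained or used. *)

Section processes.
Context {d : measure_display} {Omega : measurableType d} {R : realType}
        (P : probability Omega R).
Implicit Types X Y J S B W : R -> {RV P >-> R}.

Definition increment X (s t : R) (w : Omega) : R := X t w - X s w.

(* The sets A i may be taken to be setT, so the product rule over all the
   increments yields the one over every subfamily. *)
Definition independent_increments X : Prop :=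
  forall (n : nat) (t : nat -> R) (A : nat -> set R),
    0 <= t 0%N -> (forall i, t i <= t i.+1) -> (forall i, measurable (A i)) ->
    P (\bigcap_(i in `I_n) (increment X (t i) (t i.+1) @^-1` A i)) =
    (\prod_(i < n) P (increment X (t i) (t i.+1) @^-1` A i))%E.

Definition stationary_increments X : Prop :=
  forall (s t : R) (A : set R), 0 <= s -> 0 <= t -> measurable A ->
    P (increment X s (s + t) @^-1` A) = P (X t @^-1` A).

Record levy_process X : Prop := LevyProcess {
  levy0 : forall w, X 0 w = 0 ;
  levy_right_continuous : forall w t, 0 <= t ->
    X s w @[s --> t^'+] --> X t w ;
  levy_left_limits : forall w t, 0 < t -> cvg (X s w @[s --> t^'-]) ;
  levy_independent : independent_increments X ;
  levy_stationary : stationary_increments X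
}.

Definition subordinator S : Prop :=
  levy_process S /\ forall w s t, 0 <= s -> s <= t -> S s w <= S t w.

(* The Gaussian clause is restricted to s < t because [normal_prob m 0] is not
   the Dirac mass at m. *)
Record brownian_motion W : Prop := BrownianMotion {
  brownian0 : forall w, W 0 w = 0 ;
  brownian_continuous : forall w,
    {within `[0, +oo[%classic, continuous (fun t => W t w)} ;
  brownian_independent : independent_increments W ;
  brownian_gaussian : forall (s t : R) (A : set R),
    0 <= s -> s < t -> measurable A ->
    P (increment W s t @^-1` A) = normal_prob 0 (Num.sqrt (t - s)) A
}.

(* For sigma = 0 this is the pure drift b * t, and Omega is not required to
   carry a Brownian motion. *)
Definition drifted_brownian_motion (b sigma : R) B : Prop :=
  exists W, (sigma != 0 -> brownian_motion W) /\
    forall t w, 0 <= t -> B t w = b * t + sigma * W t w.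

Definition process_sigma_algebra X : set (set Omega) :=
  <<s [set E | exists t (A : set R),
         [/\ 0 <= t, measurable A & E = X t @^-1` A]] >>.

Definition independent_processes X Y : Prop :=
  forall E F : set Omega,
    process_sigma_algebra X E -> process_sigma_algebra Y F ->
    P (E `&` F) = (P E * P F)%E.

(* The drift b need not be the coefficient c of the Laplace exponent: the
   subordinator may itself have a drift, and c is the total one. *)
Definition subordinator_plus_brownian (sigma : R) J : Prop :=
  levy_process J /\
  exists (b : R) S B,
    [/\ subordinator S,
        drifted_brownian_motion b sigma B,
        independent_processes S B &
        forall t w, 0 <= t -> J t w = S t w + B t w].

Definition laplace_exponent J (alpha : R) : R :=
  - ln (fine 'E_P[fun w => expR (- alpha * J 1 w)]).

Definition mean_drift J : R := fine 'E_P[J 1].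

(* phi'(0+), for phi the Laplace exponent *)
Definition laplace_exponent_slope0 J : R :=
  lim (derive1 (laplace_exponent J) alpha @[alpha --> 0^'+]).

Definition psi J (alpha : R) : R :=
  alpha * laplace_exponent_slope0 J / laplace_exponent J alpha.

(* The limit is taken in \bar R since it may be infinite. *)
Definition psi_coef J (i : nat) : \bar R :=
  lim ((derive1n i (psi J) alpha)%:E @[alpha --> 0^'+]).

Definition hitting_time J (x : R) (w : Omega) : \bar R :=
  ereal_inf [set t%:E | t in [set t : R | 0 <= t /\ x + J t w = 0]].

Local Open Scope ereal_scope.

(* f takes values in \bar R because Gamma_a f may be infinite, and such
   functions are fed back into Gamma_a. Since J has no negative jumps,
   x + J t w >= 0 on [0, tau_x[, so only f on the nonnegative reals matters. *)
Definition path_area J (f : R -> \bar R) (x : R) (w : Omega) : \bar R :=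
  \int[lebesgue_measure]_(t in
      [set t : R | (0 <= t)%R /\ t%:E < hitting_time J x w])
    f (x + J t w)%R.

Definition Gamma_a J (f : R -> \bar R) (x : R) : \bar R :=
  \int[P]_w path_area J f x w.

(* Gamma_a f_1 Gamma_a f_2 ... Gamma_a f_m =
   Gamma_a (f_1 * Gamma_a (f_2 * ... Gamma_a f_m)); the innermost factor is
   multiplied by 1. *)
Definition Gamma_a_string J (fs : seq (R -> \bar R)) : R -> \bar R :=
  foldr (fun f g => Gamma_a J (fun y => f y * g y)) (cst 1) fs.

End processes.

Section nested_sum.
Context {R : realType}.
Local Open Scope ereal_scope.

Definition power_fun (k : nat) : R -> \bar R := fun y => (y ^+ k)%:E.

(* e is the partial sum of the k_j + 1 - i_j over the indices j already bound,
   so that n = n_r below; the subtractions are not truncated as i <= n. *)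
Fixpoint nested_sum (p : nat -> \bar R) (x : R) (ks : seq nat) (e : nat) :
    \bar R :=
  if ks is k :: ks' then
    let n := (k + e)%N in
    \sum_(0 <= i < n.+1)
      ('C(n, i)%:R)%:E * (((-1) ^+ i)%:E * p i) * ((n - i + 1)%:R^-1)%:E *
      nested_sum p x ks' (e + (k + 1) - i)
  else (x ^+ e)%:E.

End nested_sum.

(* Main.v *)
Require Import Defs.
From HB Require Import structures.
From mathcomp Require Import all_boot all_order all_algebra.
From mathcomp Require Import all_classical all_reals all_analysis.
From mathcomp Require Import measurable_realfun.
From mathcomp Require Import ring lra.
Import Order.TTheory GRing.Theory Num.Theory.
Import numFieldNormedType.Exports.
Set Implicit Arguments.
Unset Strict Implicit.
Unset Printing Implicit Defensive.
Local Open Scope classical_set_scope.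
Local Open Scope ring_scope.

(** Write W_t = x + J_t, let phi be the Laplace exponent, rho < 0 the mean drift
    and mu_x the occupation measure of W before it hits 0, that is the image of
    P (x) Lebesgue on {(w, t) | t < tau_x} under W.  Since
    Gamma_a f (x) = \int f d mu_x, the theorem only needs the moments of mu_x.
    These follow from the Laplace transform of mu_x, which has a closed form
    because J has no negative jumps: the path cannot jump over 0, so
    W_tau = 0 and Kella-Whitt's martingale e^(-a W_t) + phi(a) \int_0^t e^(-a W),
    stopped at tau, gives
      -phi(a) \int e^(-a y) mu_x(dy) = 1 - e^(-a x)     [occupation_identity].

    To make this rigorous the process is observed on the dyadic grids of mesh
    2^-n.  Independence of the increments makes the stopped walk satisfy the identity
    exactly, up to the value of e^(-a W) at the exit time [exit_occupation].
    As n grows the exit times decrease to a time at which W >= 0, because an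
    upward jump cannot bring the path below the limit of its past values
    [exit_time_cvg]; the exit values are then at most 1 in the limit, with
    uniformly bounded second moments, which gives one inequality
    [occupation_upper].  It bounds the total mass of mu_x by x / -rho
    [measure_alive_dyadic], so that walks surviving up to a horizon N have
    probability O(1/N), which gives the other inequality [occupation_lower].
    The role of {t < tau_x} is played by the measurable set of pairs (w, t) with
    W > 0 at all dyadic times up to t [alive_dyadic].

    With psi(a) = a rho / phi(a) the identity reads
      -rho \int e^(-a y) mu_x(dy) = psi(a) \int_0^x e^(-a u) du.
    Differentiating k times in a, Leibniz' rule expresses the k-th moment of
    e^(-a y) mu_x(dy) through (-1)^i psi^(i)(a) and \int_0^x u^j e^(-a u) du
    [alternating_leibniz]; solving for the last term also shows, inductively,
    that psi is smooth on ]0, +oo[.  Letting x tend to 0 in that formula yields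
    (-1)^i psi^(i) >= 0 [alternating_psi_ge0]: psi is completely monotone, so all
    its derivatives have limits at 0+, and a -> 0+ gives
      -rho \int y^k mu_x(dy)
        = \sum_i C(k, i) (-1)^i psi_i x^(k-i+1) / (k-i+1)   [occupation_moment].
    The coefficients (-1)^i psi_i lie in [0, +oo], so that infinite ones create no
    indeterminate form.

    Applying the last formula to each monomial of a nested sum appends one more
    level to it [integral_nested_sum]; induction on the string then gives the
    theorem.  Two facts link the integral over alive_dyadic with Gamma_a: for
    y < x the pairs alive from y satisfy t < tau_x, and those are alive from x
    [alive_before_hitting, before_hitting_alive].  So Gamma_a f (x) lies between
    the integrals at y and at x, and these agree as y tends to x because a nested
    sum Q with nonnegative coefficients satisfies Q(l x) >= l^N Q(x) for
    0 < l < 1 [nested_sum_scale, Gamma_a_occupation]. *)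

(** * Integration and independence *)

Section integration.
Local Open Scope ereal_scope.
(** The integral of a nonnegative function is a supremum over the simple functions
    below it, hence monotone without any measurability. Path areas enter Gamma_a
    without a proof that they are measurable in w, and this bypasses the issue. *)
Lemma le_integral_nonmeasurable d (T : measurableType d) (R : realType)
    (mu : {measure set T -> \bar R}) (f g : T -> \bar R) :
  (forall x, 0 <= f x) -> (forall x, f x <= g x) ->
  \int[mu]_x f x <= \int[mu]_x g x.
Proof.
move=> f0 fg; have g0 x : 0 <= g x by exact: le_trans (f0 x) (fg x).
rewrite !ge0_integralTE//; apply: le_ereal_sup => _ [h /= hf <-].
by exists h => //= x; exact: le_trans (hf x) (fg x).
Qed.

(** By uniqueness of the product measure, the joint distribution of X and Y is the
    product of their distributions; then Tonelli. *)
Lemma expectation_indepM d (T : measurableType d) (R : realType)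
    (P : probability T R) (X Y : T -> R) :
  measurable_fun setT X -> measurable_fun setT Y ->
  (forall w, 0 <= X w)%R -> (forall w, 0 <= Y w)%R ->
  (forall A B : set R, measurable A -> measurable B ->
     P (X @^-1` A `&` Y @^-1` B) = P (X @^-1` A) * P (Y @^-1` B)) ->
  \int[P]_w (X w * Y w)%:E = \int[P]_w (X w)%:E * \int[P]_w (Y w)%:E.
Proof.
move=> mX mY X0 Y0 XY.
pose X' : {mfun T >-> R} := HB.pack X (isMeasurableFun.Build _ _ _ _ X mX).
pose Y' : {mfun T >-> R} := HB.pack Y (isMeasurableFun.Build _ _ _ _ Y mY).
have mXY : measurable_fun setT (fun w => (X w, Y w)).
  exact: measurable_fun_pair.
pose XY' : {mfun T >-> (R * R)%type} := HB.pack (fun w => (X w, Y w))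
  (isMeasurableFun.Build _ _ _ _ _ mXY).
have muE : forall A, measurable A ->
    (distribution P X' \x distribution P Y')%E A = distribution P XY' A.
  apply: product_measure_unique => A B mA mB.
  exact: XY.
(* truncated below at 0 so that the integrand is nonnegative off the ranges of X
   and Y, where Tonelli is still applied *)
pose f (z : R * R) : \bar R := (((Num.max 0 z.1) * (Num.max 0 z.2))%R : R)%:E.
have mf : measurable_fun setT f.
  apply/measurable_EFinP; apply: measurable_funM;
  by apply: measurable_maxr => //.
have f0 z : 0 <= f z.
  by rewrite lee_fin mulr_ge0// le_max lexx.
transitivity (\int[distribution P XY']_z f z).
  rewrite ge0_integral_pushforward//; apply: eq_integral => w _ /=.
  by rewrite /f /= !max_r.
rewrite (eq_measure_integral (distribution P X' \x distribution P Y')%E); last first.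
  by move=> A mA _; exact: esym (muE A mA).
rewrite fubini_tonelli1//.
have mM : measurable_fun setT (fun y : R => (Num.max 0 y)%:E).
  by apply/measurable_EFinP; exact: measurable_maxr.
have M0 (y : R) : 0 <= (Num.max 0 y)%:E by rewrite lee_fin le_max lexx.
transitivity (\int[distribution P X']_x ((Num.max 0 x)%:E * \int[distribution P Y']_y (Num.max 0 y)%:E)).
  apply: eq_integral => x _; rewrite /fubini_F -ge0_integralZl//.
rewrite ge0_integralZr//; last exact: integral_ge0.
congr (_ * _); rewrite ge0_integral_pushforward//; apply: eq_integral => w _ /=;
  by rewrite max_r.
Qed.
End integration.

(** * Additive functions on the half-line *)

Section cauchy.
Variable R : realType.
(** A nonpositive additive function is nonincreasing; comparing a (n t) with its
    values at the two integers around n t gives a (t) = t a (1) up to an error O(1/n). *)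
Lemma additive_le0_linear (a : R -> R) :
  (forall s t, 0 <= s -> 0 <= t -> a (s + t) = a s + a t) ->
  (forall t, 0 <= t -> a t <= 0) ->
  forall t, 0 <= t -> a t = t * a 1.
Proof.
move=> aD a0.
have a00 : a 0 = 0.
  by have := aD 0 0 (lexx _) (lexx _); rewrite addr0 => /eqP; rewrite -subr_eq subrr => /eqP.
have aMn n t : 0 <= t -> a (n%:R * t) = n%:R * a t.
  move=> t0; elim: n => [|n IH]; first by rewrite !mul0r.
  by rewrite -!natr1 !mulrDl !mul1r aD ?mulr_ge0// IH.
have nin s t : 0 <= s -> s <= t -> a t <= a s.
  move=> s0 st; rewrite -(subrKC s t) aD ?subr_ge0// gerDl a0// subr_ge0//.
move=> t t0.
have bnd n : `|n.+1%:R * (a t - t * a 1)| <= - a 1.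
  have nt0 : 0 <= n.+1%:R * t by rewrite mulr_ge0.
  set m := Num.truncn (n.+1%:R * t).
  have /andP[ml mu] := truncn_itv nt0.
  have := nin _ _ (ler0n _ m) ml.
  have := nin _ _ nt0 (ltW mu).
  rewrite -/m -(mulr1 m%:R) -(mulr1 m.+1%:R) !aMn// => h1 h2.
  have a1 := a0 1 ler01.
  rewrite mulrBr ler_norml; apply/andP; split.
    have : n.+1%:R * t * a 1 <= m%:R * a 1 by rewrite ler_wnM2r.
    rewrite -natr1 in h1; nra.
  have : m.+1%:R * a 1 <= n.+1%:R * t * a 1 by rewrite ler_wnM2r// ltW.
  rewrite -natr1; nra.
apply/eqP; rewrite -subr_eq0 -normr_le0 leNgt; apply/negP => d0.
set D := `|_| in d0.
have := bnd (Num.truncn (- a 1 / D)).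
rewrite normrM ger0_norm// -/D -ler_pdivlMr// leNgt truncnS_gt//.
Qed.
End cauchy.

(** * Exponential moments of Gaussian variables *)

Section density.
Local Open Scope ereal_scope.
Context d (T : measurableType d) (R : realType).
Variables (mu nu : {measure set T -> \bar R}) (g : T -> R).
Hypotheses (mg : measurable_fun setT g) (g0 : forall x, (0 <= g x)%R).
Hypothesis nuE : forall A, measurable A -> nu A = \int[mu]_(x in A) (g x)%:E.

Import HBNNSimple.

(** Both sides are linear in f and agree on indicators; monotone approximation
    passes to measurable functions below. *)
Let integral_density_nnsfun (f : {nnsfun T >-> R}) :
  \int[nu]_x (f x)%:E = \int[mu]_x (f x * g x)%:E.
Proof.
have fg x : (f x * g x)%:E = \sum_(y \in range f) ((y * \1_(f @^-1` [set y]) x)%:E * (g x)%:E).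
  rewrite {1}fimfunE EFinM -fsumEFin// ge0_mule_fsuml// => r.
  by rewrite EFinM nnfun_muleindic_ge0.
under [LHS]eq_integral do rewrite fimfunE -fsumEFin//.
under [RHS]eq_integral do rewrite fg.
rewrite [LHS]ge0_integral_fsum//; last 2 first.
  - by move=> r; exact/measurable_EFinP/measurableT_comp.
  - by move=> n x _; rewrite EFinM nnfun_muleindic_ge0.
rewrite [RHS]ge0_integral_fsum//; last 2 first.
  - move=> r; apply: emeasurable_funM; apply/measurable_EFinP => //.
    exact: measurableT_comp.
  - by move=> n x _; rewrite mule_ge0 ?lee_fin//; have := nnfun_muleindic_ge0 f n x; rewrite -EFinM lee_fin.
apply: eq_fsbigr => r /[!inE] -[w _ <-].
have mI : measurable (f @^-1` [set f w]) by exact: measurable_funPTI.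
under [LHS]eq_integral do rewrite EFinM.
under [RHS]eq_integral do rewrite EFinM -muleA.
rewrite !ge0_integralZl ?lee_fin//; last 3 first.
- by apply: emeasurable_funM; apply/measurable_EFinP.
- by move=> x _; rewrite mule_ge0// lee_fin.
- exact/measurable_EFinP.
congr (_ * _); rewrite integral_indic// setIT nuE// integral_mkcond.
apply: eq_integral => x _; rewrite patchE indicE; case: ifPn => _.
  by rewrite mul1e.
by rewrite mul0e.
Qed.

Lemma ge0_integral_density (f : T -> \bar R) : measurable_fun setT f ->
  (forall x, 0 <= f x) -> \int[nu]_x f x = \int[mu]_x (f x * (g x)%:E).
Proof.
move=> mf f0; pose f_ := nnsfun_approx measurableT mf.
have ndf x : {homo (fun n => (f_ n x)%:E) : n m / (n <= m)%N >-> n <= m}.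
  by move=> m n mn; rewrite lee_fin; exact/lefP/nd_nnsfun_approx.
have cf x : (f_ n x)%:E @[n --> \oo] --> f x by exact: cvg_nnsfun_approx.
have l1 : \int[nu]_x (f_ n x)%:E @[n --> \oo] --> \int[nu]_x f x.
  rewrite (eq_integral (fun x => limn (fun n => (f_ n x)%:E))); last first.
    by move=> x _; apply/esym/cvg_lim.
  apply: cvg_monotone_convergence => //.
  - by move=> n; exact/measurable_EFinP.
  - by move=> n x _; rewrite lee_fin.
have l2 : \int[mu]_x (f_ n x * g x)%:E @[n --> \oo] --> \int[mu]_x (f x * (g x)%:E).
  rewrite (eq_integral (fun x => limn (fun n => (f_ n x * g x)%:E))); last first.
    move=> x _; apply/esym/cvg_lim => //.
    under eq_fun do rewrite EFinM.
    exact: cvgeZr.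
  apply: cvg_monotone_convergence => //.
  - by move=> n; exact/measurable_EFinP/measurable_funM.
  - by move=> n x _; rewrite lee_fin mulr_ge0.
  - by move=> x _ m n mn; rewrite !EFinM lee_wpmul2r ?lee_fin//; exact/lefP/nd_nnsfun_approx.
apply: (cvg_unique _ l1) => //.
by move: l2; under eq_fun do rewrite -integral_density_nnsfun.
Qed.
End density.

Section normal_mgf.
Local Open Scope ereal_scope.
(** Completing the square: exponential tilting of a centred Gaussian density is a
    shift of its mean. *)
Lemma normal_pdf_expR (R : realType) (s b x : R) : (0 < s)%R ->
  (expR (b * x) * normal_pdf 0 s x = expR (b ^+ 2 * s ^+ 2 / 2) * normal_pdf (b * s ^+ 2) s x)%R.
Proof.
move=> s0; rewrite !normal_pdfE ?gt_eqF// !(mulrCA _ (normal_peak s)); congr (_ * _)%R.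
rewrite /normal_fun -!expRD; congr expR.
by field; rewrite gt_eqF.
Qed.

Lemma expectation_expR_normal d (T : measurableType d) (R : realType) (P : probability T R)
    (X : {RV P >-> R}) (s b : R) : (0 < s)%R ->
  (forall A, measurable A -> P (X @^-1` A) = normal_prob 0 s A) ->
  \int[P]_w (expR (b * X w))%:E = (expR (b ^+ 2 * s ^+ 2 / 2))%:E.
Proof.
move=> s0 XN.
have mE : measurable_fun setT (fun y : R => (expR (b * y))%:E).
  by apply/measurable_EFinP; apply: measurableT_comp => //; exact: measurable_funM.
(* the Lebesgue measure lives on [measurableTypeR R] *)
have mX : measurable_fun setT (X : T -> measurableTypeR R) by exact: (@measurable_funPT _ _ _ _ X).
pose X' : {mfun T >-> measurableTypeR R} :=
  HB.pack (X : T -> measurableTypeR R) (isMeasurableFun.Build _ _ _ _ _ mX).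
transitivity (\int[distribution P X']_y (expR (b * y))%:E).
  by rewrite ge0_integral_pushforward// => y _; rewrite lee_fin expR_ge0.
rewrite (@ge0_integral_density _ _ _ lebesgue_measure _ (normal_pdf 0 s))//.
- under eq_integral do rewrite -EFinM normal_pdf_expR// EFinM.
  rewrite ge0_integralZl//.
  + by rewrite integral_normal_pdf mule1.
  + by apply/measurable_EFinP; exact: measurable_normal_pdf.
  + by move=> y _; rewrite lee_fin normal_pdf_ge0.
- exact: measurable_normal_pdf.
- exact: normal_pdf_ge0.
Qed.
End normal_mgf.

(** * Moments of an exponentially tilted measure *)

Section laplace.
Context d (T : measurableType d) (R : realType).
Variables (mu : {measure set T -> \bar R}) (D : set T) (f : T -> R).
Hypotheses (mD : measurable D) (mf : measurable_fun D f).
Hypothesis f0 : forall x, D x -> 0 <= f x.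
Hypothesis fin : forall a, 0 < a -> (\int[mu]_(x in D) (expR (- a * f x))%:E < +oo)%E.

Definition laplace_moment (k : nat) (a : R) : \bar R :=
  (\int[mu]_(x in D) (f x ^+ k * expR (- a * f x))%:E)%E.

(** From v <= e^v at v = e u / (k+1), raised to the power k. A power of f is thus
    absorbed by a fraction of the exponential weight. *)
Lemma exprn_expR_bounded (k : nat) (e u : R) : 0 < e -> 0 <= u ->
  u ^+ k * expR (- e * u) <= (k.+1%:R / e) ^+ k.
Proof.
move=> e0 u0; rewrite mulNr expRN ler_pdivrMr ?expR_gt0//.
have k0 : (0 : R) < k.+1%:R by [].
have h : u <= k.+1%:R / e * expR (e * u / k.+1%:R).
  rewrite mulrAC ler_pdivlMr// -ler_pdivrMl// mulrC (mulrC u).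
  by apply: le_trans (expR_ge1Dx _); rewrite lerDr.
apply: (@le_trans _ _ ((k.+1%:R / e * expR (e * u / k.+1%:R)) ^+ k)).
  by rewrite lerXn2r ?nnegrE// mulr_ge0 ?divr_ge0 ?expR_ge0// ltW.
rewrite exprMn ler_wpM2l//; first by rewrite exprn_ge0// divr_ge0// ltW.
rewrite -expRM_natl ler_expR mulrCA ler_piMr//; first by rewrite mulr_ge0// ltW.
by rewrite ler_pdivrMr// mul1r ler_nat.
Qed.

Lemma measurable_laplace_moment k a :
  measurable_fun D (fun x => (f x ^+ k * expR (- a * f x))%:E).
Proof.
apply/measurable_EFinP; apply: measurable_funM; first exact: measurable_funX.
by apply: measurableT_comp => //; exact: measurable_funM.
Qed.

Lemma laplace_moment_ge0 k a : (0 <= laplace_moment k a)%E.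
Proof.
by apply: integral_ge0 => x Dx; rewrite lee_fin mulr_ge0 ?expR_ge0 ?exprn_ge0 ?f0.
Qed.

Let integrable_expR a : 0 < a -> mu.-integrable D (EFin \o (fun x => expR (- a * f x))).
Proof.
move=> a0; apply/integrableP; split.
  by apply/measurable_EFinP; apply: measurableT_comp => //; exact: measurable_funM.
under eq_integral do rewrite /= ger0_norm ?expR_ge0//.
exact: fin.
Qed.

Lemma laplace_moment_integrable k a : 0 < a ->
  mu.-integrable D (EFin \o (fun x => f x ^+ k * expR (- a * f x))).
Proof.
move=> a0; pose C := (k.+1%:R / (a / 2)) ^+ k.
have h := integrableZl mD C (integrable_expR (divr_gt0 a0 (ltr0n _ 2))).
apply: le_integrable h => //; first exact: measurable_laplace_moment.
move=> x Dx /=; rewrite lee_fin !ger0_norm ?mulr_ge0 ?expR_ge0 ?exprn_ge0 ?f0//.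
  rewrite [X in expR (- X * _)](splitr a) opprD mulrDl expRD mulrA ler_wpM2r ?expR_ge0//.
  by apply: exprn_expR_bounded; [exact: divr_gt0|exact: f0].
by rewrite divr_ge0// divr_ge0// ltW.
Qed.

Lemma laplace_moment_fin_num k a : 0 < a -> laplace_moment k a \is a fin_num.
Proof. by move=> /(laplace_moment_integrable k) /(integrable_fin_num mD). Qed.

(** Differentiation under the integral sign: near a the derivative of the integrand
    is dominated by a multiple of exp (- (a / 4) f), since the factor f^(k+1) is
    absorbed by another quarter of the weight. *)
Lemma laplace_moment_derive k (a : R) : 0 < a ->
  is_derive a 1 (fun a : R => fine (laplace_moment k a) : R) (- fine (laplace_moment k.+1 a)).
Proof.
move=> a0.
pose F a x := f x ^+ k * expR (- a * f x).
have dF (b : R) x : is_derive b 1 (F ^~ x) (- (f x ^+ k.+1 * expR (- b * f x))).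
  rewrite /F; apply: is_derive_eq.
  by rewrite /GRing.scale/= exprSr; ring.
have d1F b x : ((F ^~ x)^`())%classic b = - (f x ^+ k.+1 * expR (- b * f x)).
  by rewrite derive1E; exact: derive_val.
have Ia : `]a / 2, 2 * a[%classic a by rewrite /= in_itv/=; apply/andP; split; lra.
have a4 : 0 < a / 4 by lra.
pose C := (k.+2%:R / (a / 4)) ^+ k.+1.
pose G x := C * expR (- (a / 4) * Num.max 0 (f x)).
have C0 : 0 <= C by rewrite exprn_ge0// divr_ge0// ltW.
have G0 x : 0 <= G x by rewrite mulr_ge0 ?expR_ge0.
have intG : mu.-integrable D (EFin \o G).
  have h := integrableZl mD C (integrable_expR a4).
  apply: eq_integrable h => // x /[!inE] Dx /=.
  by rewrite /G max_r ?f0.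
have intF b : `]a / 2, 2 * a[%classic b -> mu.-integrable D (EFin \o F b).
  rewrite /= in_itv/= => /andP[h _]; apply: laplace_moment_integrable; lra.
have Gub b x : `]a / 2, 2 * a[%classic b -> D x -> `|partial1of2 F b x| <= G x.
  rewrite /= in_itv/= => /andP[h _] Dx; rewrite /partial1of2 d1F normrN.
  rewrite ger0_norm ?mulr_ge0 ?expR_ge0 ?exprn_ge0 ?f0// /G max_r ?f0//.
  have -> : - b * f x = - (a / 4) * f x + - (b - a / 4) * f x by ring.
  rewrite expRD mulrA ler_pM ?mulr_ge0 ?expR_ge0 ?exprn_ge0 ?f0//.
    exact: exprn_expR_bounded (f0 Dx).
  by rewrite ler_expR ler_wpM2r ?f0//; lra.
have dF' b x : `]a / 2, 2 * a[%classic b -> D x -> derivable (F^~ x) b 1.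
  by move=> _ _; exact: ex_derive.
have D1 := @derivable_under_integral _ _ _ mu F D mD a _ _ Ia intF dF' G G0 intG Gub.
have D2 := @differentiation_under_integral _ _ _ mu F D mD a _ _ Ia intF dF' G G0 intG Gub.
apply: DeriveDef; first exact: D1.
rewrite -derive1E D2 /laplace_moment /Rintegral.
rewrite (eq_integral (fun x => - (f x ^+ k.+1 * expR (- a * f x))%:E)%E).
  by rewrite integralN ?fineN//; apply: (integrable_add_def mD); exact: (laplace_moment_integrable k.+1 a0).
by move=> x _; rewrite /partial1of2 d1F EFinN.
Qed.

Lemma laplace_moment_nonincreasing k a b : a <= b ->
  (laplace_moment k b <= laplace_moment k a)%E.
Proof.
move=> ab; apply: ge0_le_integral => //.
- by move=> x Dx; rewrite lee_fin mulr_ge0 ?expR_ge0 ?exprn_ge0 ?f0.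
- exact: measurable_laplace_moment.
- exact: measurable_laplace_moment.
- move=> x Dx; rewrite lee_fin ler_wpM2l ?exprn_ge0 ?f0// ler_expR.
  by rewrite ler_wpM2r ?f0// lerN2.
Qed.

(** Monotone convergence; the limit may be infinite. *)
Lemma cvg_laplace_moment k :
  laplace_moment k a @[a --> 0^'+] --> (\int[mu]_(x in D) (f x ^+ k)%:E)%E.
Proof.
have mX : measurable_fun D (fun x => (f x ^+ k)%:E).
  by apply/measurable_EFinP; exact: measurable_funX.
have -> : (\int[mu]_(x in D) (f x ^+ k)%:E)%E =
    ereal_sup (laplace_moment k @` [set` `]0, +oo[%R]).
  apply/eqP; rewrite eq_le; apply/andP; split.
    have c : laplace_moment k (n.+1%:R^-1) @[n --> \oo] --> (\int[mu]_(x in D) (f x ^+ k)%:E)%E.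
      rewrite [X in _ --> X](_ : _ = \int[mu]_(x in D) limn (fun n : nat => (f x ^+ k * expR (- (n.+1%:R^-1) * f x))%:E))%E.
        apply: cvg_monotone_convergence => //.
        - by move=> n; exact: measurable_laplace_moment.
        - by move=> n x Dx; rewrite lee_fin mulr_ge0 ?expR_ge0 ?exprn_ge0 ?f0.
        - move=> x Dx m n mn; rewrite lee_fin ler_wpM2l ?exprn_ge0 ?f0// ler_expR.
          by rewrite ler_wpM2r ?f0// lerN2 lef_pV2 ?posrE// ler_nat.
      apply: eq_integral => x /[!inE] Dx; apply/esym/cvg_lim => //.
      apply: cvg_EFin; first exact: nearW.
      rewrite -[X in _ --> X]mulr1; apply: cvgMr.
      rewrite -[X in _ --> X]expR0; apply: continuous_cvg; first exact: continuous_expR.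
      suff : - n.+1%:R^-1 * f x @[n --> \oo] --> - 0 * f x by rewrite oppr0 mul0r.
      by apply: cvgMl; apply: cvgN; exact: cvg_harmonic.
    rewrite -(cvg_lim _ c)//; apply: lime_le; first by apply/cvg_ex; eexists; exact: c.
    apply: nearW => n; apply: ereal_sup_ubound; exists n.+1%:R^-1 => //=.
    by rewrite in_itv/= andbT invr_gt0.
  apply/ereal_supP => y [a /=]; rewrite in_itv/= andbT => a0 ya; rewrite -{y}ya.
  have -> : (\int[mu]_(x in D) (f x ^+ k)%:E)%E = laplace_moment k 0.
    by apply: eq_integral => x _; rewrite oppr0 mul0r expR0 mulr1.
  by apply: laplace_moment_nonincreasing; exact: ltW.
apply: (@nonincreasing_at_right_cvge _ _ _ (BInfty _ false)) => //.
by move=> a b _ _; exact: laplace_moment_nonincreasing.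
Qed.
End laplace.

(** * Uniform integrability from a second moment bound *)

Section uniform_integrability.
Context d (T : measurableType d) (R : realType) (P : probability T R).
(** A bounded second moment makes the X n uniformly integrable. Truncating at A, the
    truncated variables converge by domination and the excess is at most X^2 / A. *)
Lemma limsup_expectation_le1 (X : nat -> T -> R) (l : T -> R) (K : R) :
  (forall n, measurable_fun setT (X n)) -> (forall n w, 0 <= X n w) ->
  (forall n, (\int[P]_w (X n w ^+ 2)%:E <= K%:E)%E) ->
  (forall w, X n w @[n --> \oo] --> l w) -> (forall w, l w <= 1) ->
  forall e, 0 < e -> \forall n \near \oo, (\int[P]_w (X n w)%:E <= (1 + e)%:E)%E.
Proof.
move=> mX X0 XK Xl l1 e e0.
have K0 : 0 <= K.
  have := XK 0%N; rewrite -lee_fin; apply: le_trans; apply: integral_ge0 => w _.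
  by rewrite lee_fin sqr_ge0.
(* the excess K / A over the truncation is then at most e / 2 *)
pose A := Num.max 1 (2 * K / e).
have A1 : 1 <= A by rewrite /A le_max lexx.
have A0 : 0 < A by exact: lt_le_trans A1.
have KA : K / A <= e / 2.
  rewrite ler_pdivrMr// mulrC -ler_pdivrMr ?divr_gt0//.
  by rewrite invf_div mulrA (mulrC K) /A le_max lexx orbT.
have mlim : (\int[P]_w (Num.min (X n w) A)%:E)%E @[n --> \oo] --> (\int[P]_w (Num.min (l w) A)%:E)%E.
  apply: (@dominated_cvg _ _ _ _ _ _ _ _ (cst A%:E)) => //.
  - by move=> n; apply/measurable_EFinP; exact: measurable_minr.
  - move=> w _; apply: cvg_EFin; first exact: nearW.
    rewrite /comp /= minr_absE; under eq_fun do rewrite minr_absE.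
    apply: cvgMl; apply: cvgB; first by apply: cvgD; [exact: Xl|exact: cvg_cst].
    by apply: cvg_norm; apply: cvgB; [exact: Xl|exact: cvg_cst].
  - exact: finite_measure_integrable_cst.
  - move=> n w _; rewrite gee0_abs ?lee_fin ?le_min ?X0 ?(ltW A0)//.
    by rewrite ge_min lexx orbT.
have ml : measurable_fun setT l.
  by apply: (@measurable_fun_cvg _ _ _ setT X) => // w _; exact: Xl.
have lm : (\int[P]_w (Num.min (l w) A)%:E < (1 + e / 2)%:E)%E.
  apply: (@le_lt_trans _ _ (\int[P]_w (cst 1%E) w)%E).
    apply: ge0_le_integral => //.
    - move=> w _; rewrite lee_fin le_min (ltW A0) andbT.
      rewrite -(cvg_lim _ (Xl w))//; apply: limr_ge; last exact: nearW.
      by apply/cvg_ex; eexists; exact: Xl.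
    - by apply/measurable_EFinP; exact: measurable_minr.
    - by move=> w _; rewrite lee_fin ge_min l1.
  rewrite integral_cst// mul1e; apply: (@le_lt_trans _ _ 1%E); first exact: probability_le1.
  by rewrite lte_fin ltrDl divr_gt0.
have : \forall n \near \oo, (\int[P]_w (Num.min (X n w) A)%:E < (1 + e / 2)%:E)%E.
  apply: (mlim [set y : \bar R | y < (1 + e / 2)%:E]%E).
  by apply: open_nbhs_nbhs; split => //; exact: open_ereal_lt_ereal.
apply: filterS => n hn.
apply: (@le_trans _ _ (\int[P]_w ((Num.min (X n w) A)%:E + (A^-1 * X n w ^+ 2)%:E))%E).
  apply: ge0_le_integral => //.
  - by move=> w _; rewrite lee_fin.
  - exact/measurable_EFinP.
  - apply/measurable_EFinP; apply: measurable_funD; first exact: measurable_minr.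
    by apply: measurable_funM => //; exact: measurable_funX.
  - move=> w _; rewrite -EFinD lee_fin minEle; case: ifPn => [_|].
      by rewrite lerDl mulr_ge0 ?invr_ge0 ?sqr_ge0// ltW.
    rewrite -ltNge => h; rewrite ler_wpDl ?(ltW A0)// mulrC ler_pdivlMr//.
    by rewrite expr2 ler_wpM2l// ltW.
rewrite ge0_integralD//; last 4 first.
- by move=> w _; rewrite lee_fin le_min X0 ltW.
- by apply/measurable_EFinP; exact: measurable_minr.
- by move=> w _; rewrite lee_fin mulr_ge0 ?invr_ge0 ?sqr_ge0// ltW.
- by apply/measurable_EFinP; apply: measurable_funM => //; exact: measurable_funX.
rewrite (_ : 1 + e = (1 + e / 2) + e / 2)%R; last by lra.
rewrite EFinD; apply: leeD; first exact: ltW.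
under eq_integral do rewrite EFinM.
rewrite ge0_integralZl//; last 3 first.
- by apply/measurable_EFinP; exact: measurable_funX.
- by move=> w _; rewrite lee_fin sqr_ge0.
- by rewrite lee_fin invr_ge0 ltW.
apply: (@le_trans _ _ (A^-1%:E * K%:E)%E).
  by rewrite lee_wpmul2l// lee_fin invr_ge0 ltW.
by rewrite -EFinM lee_fin mulrC.
Qed.
End uniform_integrability.

(** * Independence of the past of a Levy process *)

Section levy_markov.
Context {d : measure_display} {Omega : measurableType d} {R : realType}
        (P : probability Omega R) (J : R -> {RV P >-> R}) (LJ : levy_process J).
Implicit Types (t : nat -> R) (k : nat).

Lemma measurable_increment s u : measurable_fun setT (increment J s u).
Proof. by apply: measurable_funB. Qed.

(** The rectangles generating the sigma-algebra of the increments over the first k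
    intervals of the subdivision t. *)
Definition past t k : set (set Omega) :=
  [set E | exists2 A : nat -> set R, (forall i, measurable (A i)) &
     E = \bigcap_(i in `I_k) (increment J (t i) (t i.+1) @^-1` A i)].

Lemma past_setI_closed t k : setI_closed (past t k).
Proof.
move=> _ _ [A mA ->] [B mB ->]; exists (fun i => A i `&` B i).
  by move=> i; exact: measurableI.
by rewrite -bigcapI.
Qed.

Lemma past_measurable t k E : past t k E -> measurable E.
Proof.
move=> [A mA ->]; apply: bigcap_measurableType => //.
by move=> i _; rewrite -[X in measurable X]setTI; exact: measurable_increment.
Qed.

Lemma sigma_past_measurable t k E : <<s past t k >> E -> measurable E.
Proof.
have : <<s past t k >> `<=` measurable.
  apply: smallest_sub; first exact: sigma_algebra_measurable.
  by move=> A; exact: past_measurable.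
exact.
Qed.

(** The increment after t k is one more increment of a subdivision, to which the
    product rule applies. *)
Let past_rect_indep t k s (A : nat -> set R) (B : set R) :
  0 <= t 0%N -> (forall i, t i <= t i.+1) -> 0 <= s -> (forall i, measurable (A i)) -> measurable B ->
  let E := \bigcap_(i in `I_k) (increment J (t i) (t i.+1) @^-1` A i) in
  (P (E `&` increment J (t k) (t k + s) @^-1` B) = P E * P (J s @^-1` B))%E.
Proof.
move=> t0 nt s0 mA mB E.
pose u i := if (i <= k)%N then t i else t k + s.
pose C i := if (i < k)%N then A i else B.
have nu i : u i <= u i.+1.
  rewrite /u; case: (ltngtP i k) => // ->; by rewrite lerDl.
have mC i : measurable (C i) by rewrite /C; case: ifP.
have t0k : 0 <= t k.
  by elim: (k) => // n IH; apply: le_trans (nt n).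
have uE i : (i < k)%N -> increment J (u i) (u i.+1) @^-1` C i = increment J (t i) (t i.+1) @^-1` A i.
  by move=> ik; rewrite /u /C ik (ltnW ik).
have uk : increment J (u k) (u k.+1) @^-1` C k = increment J (t k) (t k + s) @^-1` B.
  by rewrite /u /C leqnn ltnn.
have <- : \bigcap_(i in `I_k.+1) (increment J (u i) (u i.+1) @^-1` C i) =
   E `&` increment J (t k) (t k + s) @^-1` B.
  apply/seteqP; split => [w h|w [Ew Bw] i /= ik].
    split; first by move=> i /= ik; have := h i (ltnW ik); rewrite /= /u /C ik (ltnW ik).
    by have := h k (ltnSn k); rewrite /= /u /C leqnn ltnn.
  move: ik; rewrite ltnS leq_eqVlt => /predU1P[->|ik]; first by rewrite /= /u /C leqnn ltnn.
  by have := Ew i ik; rewrite /= /u /C ik (ltnW ik).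
rewrite (levy_independent LJ)//.
rewrite big_ord_recr /= uk; congr (_ * _)%E; last exact: (levy_stationary LJ).
rewrite /E (levy_independent LJ)//.
by apply: eq_bigr => i _; rewrite uE.
Qed.

(** The rectangles are stable under intersection, so the pi-lambda theorem extends
    independence to the sigma-algebra they generate. *)
Lemma past_indep t k s (E : set Omega) (B : set R) :
  0 <= t 0%N -> (forall i, t i <= t i.+1) -> 0 <= s -> <<s past t k >> E -> measurable B ->
  (P (E `&` increment J (t k) (t k + s) @^-1` B) = P E * P (J s @^-1` B))%E.
Proof.
move=> t0 nt s0 pE mB; set F := increment _ _ _ @^-1` B.
have mF : measurable F.
  by rewrite -[X in measurable X]setTI; exact: measurable_increment.
pose H := [set E | measurable E /\ (P (E `&` F) = P E * P (J s @^-1` B))%E].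
suff /(_ _ pE) [] : <<s past t k >> `<=` H by [].
have PF : P F = P (J s @^-1` B).
  apply: (levy_stationary LJ) => //; elim: (k) => // n IH; exact: le_trans (nt n).
apply: lambda_system_subset => //.
- exact: past_setI_closed.
- apply/dynkin_lambda_system; split.
  + by split => //; rewrite setTI PF (_ : P setT = 1%E) ?mul1e//; exact: probability_setT.
  + move=> A [mA hA]; split; first exact: measurableC.
    have hD : (P (F `\` A) = P F - P (F `&` A))%E.
      by apply: measureD => //; rewrite (le_lt_trans (probability_le1 _ mF)) ?ltry.
    rewrite setIC -setDE hD setIC hA PF probability_setC//.
    rewrite muleBl// ?mul1e//.
      rewrite ge0_fin_numE//; apply: (@le_lt_trans _ _ 1%E); last exact: ltry.
      by apply: probability_le1; rewrite -[X in measurable X]setTI; exact: measurable_funPT.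
  + move=> A tA hA; split; first by apply: bigcup_measurable => k0 _; case: (hA k0).
    rewrite setI_bigcupl measure_bigcup//; last 2 first.
    * by move=> i _; apply: measurableI => //; case: (hA i).
    * by apply: trivIset_setIr.
    rewrite measure_bigcup//; last by move=> i _; case: (hA i).
    have qfin : P (J s @^-1` B) \is a fin_num.
      rewrite ge0_fin_numE//; apply: (@le_lt_trans _ _ 1%E); last exact: ltry.
      by apply: probability_le1; rewrite -[X in measurable X]setTI; exact: measurable_funPT.
    rewrite muleC -(fineK qfin) -nneseriesZl; last by [].
    by apply: eq_eseriesr => i _; rewrite fineK// muleC; case: (hA i).
- move=> A pA; split; first exact: past_measurable pA.
  by case: pA => C mC ->; exact: past_rect_indep.
Qed.

Lemma measurable_past t k j : t 0%N = 0 -> (j <= k)%N ->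
  measurable_fun setT (J (t j) : g_sigma_algebraType (past t k) -> R).
Proof.
move=> t0; elim: j => [_|j IH jk].
  rewrite (_ : (J (t 0%N) : Omega -> R) = cst 0); last first.
    by apply/funext => w; rewrite t0 (levy0 LJ).
  exact: measurable_cst.
rewrite (_ : (J (t j.+1) : Omega -> R) = (J (t j) : Omega -> R) \+ increment J (t j) (t j.+1)); last first.
  by apply/funext => w /=; rewrite /increment subrKC.
apply: measurable_funD; first exact: IH (ltnW jk).
move=> _ A mA; rewrite setTI; apply: sub_sigma_algebra.
exists (fun i => if i == j then A else setT); first by move=> i; case: ifP.
apply/seteqP; split => [w Aw i /= ik|w /(_ j jk)]; last by rewrite /= eqxx.
by case: ifP => // /eqP ->.
Qed.

Lemma increment_distribution s u (g : R -> R) : 0 <= s -> 0 <= u ->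
  measurable_fun setT g -> (forall y, 0 <= g y) ->
  (\int[P]_w (g (increment J s (s + u) w))%:E = \int[P]_w (g (J u w))%:E)%E.
Proof.
move=> s0 u0 mg g0.
pose I : {mfun Omega >-> R} := HB.pack (increment J s (s + u))
  (isMeasurableFun.Build _ _ _ _ _ (measurable_increment s (s + u))).
have mgE : measurable_fun setT (fun y => (g y)%:E) by exact/measurable_EFinP.
transitivity (\int[distribution P I]_y (g y)%:E)%E.
  by rewrite ge0_integral_pushforward// => y _; rewrite lee_fin.
transitivity (\int[distribution P (J u)]_y (g y)%:E)%E; last first.
  by rewrite ge0_integral_pushforward// => y _; rewrite lee_fin.
by apply: eq_measure_integral => A mA _; exact: (levy_stationary LJ).
Qed.

(** The Markov property at a grid time, in the form needed for the stopped walk: Z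
    is any nonnegative functional of the increments before t k. *)
Lemma levy_markov t k s (Z : Omega -> R) (g : R -> R) :
  t 0%N = 0 -> (forall i, t i <= t i.+1) -> 0 <= s ->
  measurable_fun setT (Z : g_sigma_algebraType (past t k) -> R) -> (forall w, 0 <= Z w) ->
  measurable_fun setT g -> (forall y, 0 <= g y) ->
  (\int[P]_w (Z w * g (increment J (t k) (t k + s) w))%:E =
   \int[P]_w (Z w)%:E * \int[P]_w (g (J s w))%:E)%E.
Proof.
move=> t0 nt s0 mZ Z0 mg g0.
have tk0 : 0 <= t k.
  by elim: (k) => [|n IH]; [rewrite t0|exact: le_trans (nt n)].
rewrite -(increment_distribution tk0 s0 mg g0).
apply: expectation_indepM => //.
- move=> _ A mA; rewrite setTI; apply: (@sigma_past_measurable t k).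
  by rewrite -[X in _ X]setTI; exact: mZ.
- by apply: measurableT_comp => //; exact: measurable_increment.
- move=> A B mA mB.
  have mgB : measurable (g @^-1` B) by rewrite -[X in measurable X]setTI; exact: mg.
  have pA : <<s past t k >> (Z @^-1` A) by rewrite -[X in _ X]setTI; exact: mZ.
  rewrite (_ : (fun w => g _) @^-1` B = increment J (t k) (t k + s) @^-1` (g @^-1` B))//.
  rewrite past_indep// ?t0//; congr (_ * _)%E; apply/esym; exact: (levy_stationary LJ).
Qed.
End levy_markov.

(** * The Laplace exponent *)

Section right_limit_under_integral.
Context d (T : measurableType d) (R : realType) (mu : {measure set T -> \bar R}).
(** Dominated convergence along the right-hand filter at 0, by sequences. *)
Lemma cvg_at_right0_Rintegral (h : R -> T -> R) (h0 G : T -> R) :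
  (forall a, 0 < a < 1 -> measurable_fun setT (h a)) ->
  (forall w, h a w @[a --> 0^'+] --> h0 w) ->
  mu.-integrable setT (EFin \o G) -> (forall a w, 0 < a < 1 -> `|h a w| <= G w) ->
  \int[mu]_w h a w @[a --> 0^'+] --> \int[mu]_w h0 w.
Proof.
move=> mh hh0 iG hG; apply/cvg_at_rightP => u [u0 uc].
have [N _ uN] : \forall n \near \oo, u n < 1 by apply: (cvgr_lt 0 uc); exact: ltr01.
rewrite -(cvg_shiftn N).
have u1 n : 0 < u (n + N)%N < 1 by rewrite u0/=; apply: uN => /=; exact: leq_addl.
have mh0 : measurable_fun setT h0.
  apply: (@measurable_fun_cvg _ _ _ setT (fun n => h (u (n + N)%N))) => [n|w _]; first exact: mh.
  rewrite (cvg_shiftn N (fun n => h (u n) w)).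
  by have /cvg_at_rightP := hh0 w; apply; split.
have ih0 : mu.-integrable setT (EFin \o h0).
  apply: le_integrable iG => //; first exact/measurable_EFinP.
  move=> w _ /=; rewrite lee_fin; apply: (@le_trans _ _ (G w)); last exact: ler_norm.
  have c : `|h (u (n + N)%N) w| @[n --> \oo] --> `|h0 w|.
    apply: cvg_norm; rewrite (cvg_shiftn N (fun n => h (u n) w)).
    by have /cvg_at_rightP := hh0 w; apply; split.
  rewrite -(cvg_lim _ c)//; apply: limr_le; first by apply/cvg_ex; eexists; exact: c.
  by apply: nearW => n; exact: hG.
apply: fine_cvg; rewrite fineK; last exact: integrable_fin_num.
apply: (@dominated_cvg _ _ _ _ _ _ _ _ (EFin \o G)) => //.
- by move=> n; apply/measurable_EFinP; exact: mh.
- move=> w _; apply: cvg_EFin; first exact: nearW.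
  rewrite /comp/= (cvg_shiftn N (fun n => h (u n) w)).
  by have /cvg_at_rightP := hh0 w; apply; split.
- by move=> n w _ /=; rewrite lee_fin hG.
Qed.
End right_limit_under_integral.

Section exponent.
Context {d : measure_display} {Omega : measurableType d} {R : realType}
        (P : probability Omega R) (J : R -> {RV P >-> R}).

Lemma integral_expR_gt0 (X : {RV P >-> R}) : (0 < \int[P]_w (expR (X w))%:E)%E.
Proof.
rewrite lt_neqAle integral_ge0 ?andbT => [|w _]; last by rewrite lee_fin expR_ge0.
apply/negP => /eqP /esym h.
have mE : measurable_fun setT (fun w => (expR (X w))%:E).
  by apply/measurable_EFinP; exact: measurableT_comp.
have : (\int[P]_w `|(expR (X w))%:E| = 0)%E.
  by under eq_integral do rewrite gee0_abs ?lee_fin ?expR_ge0//.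
move/(ae_eq_integral_abs P measurableT mE) => [N [mN N0 sN]].
have NT : N = setT.
  by apply/seteqP; split => // w _; apply: sN => /= /(_ Logic.I) [] /eqP; rewrite gt_eqF// expR_gt0.
have := @probability_setT _ _ _ P; rewrite -NT => N1.
by have := esym N1; rewrite [X in _ = X]N0 => /eqP; rewrite onee_eq0.
Qed.

Section mean.
Hypothesis J_integrable : P.-integrable setT (EFin \o J 1).

Lemma mean_driftE : mean_drift J = \int[P]_w J 1 w.
Proof. by rewrite /mean_drift unlock. Qed.

(** From 1 + u <= e^u at u = - a J_1. *)
Lemma expectation_expR_ge (a : R) :
  P.-integrable setT (fun w => (expR (- a * J 1 w))%:E) ->
  ((1 - a * mean_drift J)%:E <= \int[P]_w (expR (- a * J 1 w))%:E)%E.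
Proof.
move=> iE.
have i1 : P.-integrable setT (EFin \o cst (1 : R)) by exact: finite_measure_integrable_cst.
have ia := integrableZl measurableT a J_integrable.
have iL : P.-integrable setT (fun w => (1 - a * J 1 w)%:E).
  by apply: eq_integrable (integrableB _ i1 ia).
have -> : (1 - a * mean_drift J)%:E = (\int[P]_w (1 - a * J 1 w)%:E)%E.
  under eq_integral do rewrite EFinB EFinM.
  rewrite integralB// integralZl// EFinB EFinM mean_driftE /Rintegral fineK ?integrable_fin_num//.
  congr (_ - _)%E; rewrite integral_cst// mul1e; apply/esym; exact: probability_setT.
apply: le_integral => // w _.
by rewrite lee_fin mulNr; exact: expR_ge1Dx.
Qed.
End mean.

Section moments.
Variable sigma : R.
Hypothesis hJ : subordinator_plus_brownian sigma J.

Let LJ : levy_process J := hJ.1.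

(** The subordinator only decreases the exponential, and the drifted Brownian part
    has an explicit Gaussian moment. The exponential form of the bound is what makes ln E e^(-a J_t) - C t a
    nonpositive additive function of t. *)
Lemma exp_moment_bound (a : R) : 0 <= a -> exists2 C : R, 0 <= C &
  forall t, 0 <= t -> (\int[P]_w (expR (- a * J t w))%:E <= (expR (C * t))%:E)%E.
Proof.
move=> a0; case: hJ => _ [b [S [B [[LS Smon] [W [hW BE]] _ JE]]]].
exists (`|a * b| + a ^+ 2 * sigma ^+ 2 / 2).
  by rewrite addr_ge0// divr_ge0// mulr_ge0// sqr_ge0.
move=> t t0; set C := _ + _.
have mE (c : R) (X : {RV P >-> R}) : measurable_fun setT (fun w => (expR (c * X w))%:E).
  by apply/measurable_EFinP; apply: measurableT_comp => //; exact: measurable_funM.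
have S0 w : 0 <= S t w by rewrite -(levy0 LS w); exact: Smon.
have [t_eq0|tn0] := eqVneq t 0.
  rewrite t_eq0 mulr0 expR0 (eq_integral (cst 1%E)) => [|w _]; last first.
    by rewrite (levy0 LJ) mulr0 expR0.
  by rewrite integral_cst// mul1e; exact: probability_le1.
have tpos : 0 < t by rewrite lt_neqAle eq_sym tn0.
have bnd w : expR (- a * J t w) <= expR (`|a * b| * t) * expR (- a * sigma * W t w).
  rewrite -expRD ler_expR JE// BE//.
  have h1 : 0 <= a * S t w by exact: mulr_ge0.
  have h2 : - (a * b) * t <= `|a * b| * t by rewrite ler_wpM2r// -normrN; exact: ler_norm.
  lra.
apply: (@le_trans _ _ (\int[P]_w ((expR (`|a * b| * t))%:E * (expR (- a * sigma * W t w))%:E))%E).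
  apply: ge0_le_integral => //.
  - by apply: measurable_funeM; exact: mE.
  - by move=> w _; rewrite -EFinM lee_fin.
rewrite ge0_integralZl//.
have [->|sn0] := eqVneq sigma 0.
  under eq_integral do rewrite mulr0 mul0r expR0.
  rewrite integral_cst// mul1e.
  apply: (@le_trans _ _ ((expR (`|a * b| * t))%:E * 1)%E).
    by rewrite lee_wpmul2l ?lee_fin ?expR_ge0//; exact: probability_le1.
  rewrite mule1 lee_fin ler_expR; apply: ler_wpM2r => //.
  by rewrite /C lerDl divr_ge0// mulr_ge0// sqr_ge0.
have BW := hW sn0.
rewrite (@expectation_expR_normal _ _ _ _ _ (Num.sqrt t)) ?sqrtr_gt0//.
  rewrite -EFinM lee_fin -expRD ler_expR /C sqr_sqrtr//.
  rewrite le_eqVlt; apply/orP; left; apply/eqP; ring.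
move=> A mA; rewrite -[in RHS](subr0 t) -(brownian_gaussian BW (lexx 0) tpos mA).
by congr (P _); apply/seteqP; split => w /=; rewrite /increment (brownian0 BW) subr0.
Qed.

Definition laplace_transform (a t : R) : R := fine (\int[P]_w (expR (- a * J t w))%:E)%E.

Lemma laplace_transformE a t : 0 <= a -> 0 <= t ->
  (\int[P]_w (expR (- a * J t w))%:E)%E = (laplace_transform a t)%:E.
Proof.
move=> a0 t0; have [C C0 /(_ t t0) hC] := exp_moment_bound a0.
rewrite fineK// ge0_fin_numE; first exact: le_lt_trans hC (ltry _).
by apply: integral_ge0 => w _; rewrite lee_fin expR_ge0.
Qed.

Lemma integrable_expRN a t : 0 <= a -> 0 <= t ->
  P.-integrable setT (fun w => (expR (- a * J t w))%:E).
Proof.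
move=> a0 t0; apply/integrableP; split.
  by apply/measurable_EFinP; apply: measurableT_comp => //; exact: measurable_funM.
under eq_integral do rewrite gee0_abs ?lee_fin ?expR_ge0//.
by rewrite laplace_transformE// ltry.
Qed.

Lemma laplace_transform_gt0 a t : 0 <= a -> 0 <= t -> 0 < laplace_transform a t.
Proof.
move=> a0 t0; rewrite -lte_fin -laplace_transformE//.
pose X : {mfun Omega >-> R} := HB.pack (fun w => - a * J t w)
  (isMeasurableFun.Build _ _ _ _ _
    (measurable_funM (measurable_cst (- a)) (@measurable_funPT _ _ _ _ (J t)))).
exact: (@integral_expR_gt0 X).
Qed.

(** The increment J_(s+t) - J_s is independent of J_s and distributed as J_t. *)
Lemma laplace_transformD a s t : 0 <= a -> 0 <= s -> 0 <= t ->
  laplace_transform a (s + t) = laplace_transform a s * laplace_transform a t.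
Proof.
move=> a0 s0 t0; apply: EFin_inj; rewrite EFinM -!laplace_transformE//; last exact: addr_ge0.
pose u (i : nat) : R := if i is 0%N then 0 else s.
have nu i : u i <= u i.+1 by case: i.
have mE : measurable_fun setT (fun y : R => expR (- a * y)).
  by apply: measurableT_comp => //; exact: measurable_funM.
have := @levy_markov _ _ _ _ _ LJ u 1%N t (fun w => expR (- a * J s w)) (fun y => expR (- a * y))
  erefl nu t0 _ _ mE (fun y => expR_ge0 _).
rewrite /= => <- //.
- apply: eq_integral => w _; congr EFin; rewrite -expRD /increment; congr expR; ring.
- apply: (measurableT_comp mE); exact: (@measurable_past _ _ _ _ _ LJ u 1%N 1%N).
Qed.

Lemma laplace_transform1 a : 0 <= a -> laplace_transform a 1 = expR (- laplace_exponent J a).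
Proof.
move=> a0; rewrite /laplace_exponent unlock opprK lnK// posrE; exact: laplace_transform_gt0.
Qed.

(** Cauchy's equation for t |-> ln E e^(-a J_t) - C t. *)
Lemma laplace_transform_exp a t : 0 <= a -> 0 <= t ->
  laplace_transform a t = expR (- laplace_exponent J a * t).
Proof.
move=> a0 t0; have [C C0 hC] := exp_moment_bound a0.
have := @additive_le0_linear R (fun t => ln (laplace_transform a t) - C * t) _ _ t t0.
rewrite laplace_transform1// expRK => h.
rewrite -[LHS]lnK ?posrE ?laplace_transform_gt0//; congr expR.
suff : ln (laplace_transform a t) - C * t = t * (- laplace_exponent J a - C * 1) by lra.
apply: h => [s u s0 u0|u u0].
  by rewrite laplace_transformD// lnM ?posrE ?laplace_transform_gt0// mulrDr opprD addrACA.
rewrite subr_le0 -ler_expR lnK ?posrE ?laplace_transform_gt0//.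
by rewrite -lee_fin -laplace_transformE// hC.
Qed.

Lemma exp_moment a t : 0 <= a -> 0 <= t ->
  (\int[P]_w (expR (- a * J t w))%:E)%E = (expR (- laplace_exponent J a * t))%:E.
Proof. by move=> a0 t0; rewrite laplace_transformE// laplace_transform_exp. Qed.

Hypothesis J_integrable : P.-integrable setT (EFin \o J 1).
Hypothesis drift_lt0 : mean_drift J < 0.
Local Notation phi := (laplace_exponent J).
Local Notation rho := (mean_drift J).

(** E e^(-a J_1) >= 1 - a rho >= exp (- a rho / (1 - a rho)). This elementary bound
    replaces the asymptotics phi(a) ~ a rho at 0 wherever they are needed. *)
Lemma laplace_exponent_le a : 0 < a -> phi a <= a * rho / (1 - a * rho).
Proof.
move=> a0; have ar : a * rho < 0 by rewrite pmulr_rlt0.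
have u0 : 0 < 1 - a * rho by lra.
have := expectation_expR_ge J_integrable (integrable_expRN (ltW a0) ler01).
rewrite exp_moment ?(ltW a0)// mulr1 lee_fin => h.
have : 1 + a * rho / (1 - a * rho) = (1 - a * rho)^-1 by field; rewrite gt_eqF.
have := expR_ge1Dx (a * rho / (1 - a * rho)) => h1 h2.
have : expR (- (a * rho / (1 - a * rho))) <= expR (- phi a).
  apply: le_trans h; rewrite expRN -[leRHS]invrK lef_pV2 ?posrE ?invr_gt0 ?expR_gt0//.
  by rewrite -[leLHS]h2.
by rewrite ler_expR lerN2.
Qed.

Lemma laplace_exponent_lt0 a : 0 < a -> phi a < 0.
Proof.
move=> a0; apply: le_lt_trans (laplace_exponent_le a0) _.
have ar : a * rho < 0 by rewrite pmulr_rlt0.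
by rewrite pmulr_llt0// invr_gt0; lra.
Qed.

(** phi' = E (J_1 e^(-a J_1)) / E e^(-a J_1) on ]0, 1[, and both expectations
    converge by domination as a -> 0+. *)
Lemma laplace_exponent_slope0E : laplace_exponent_slope0 J = rho.
Proof.
pose F (a : R) w := expR (- a * J 1 w).
pose F' (a : R) w := - (J 1 w * expR (- a * J 1 w)).
have dF (b : R) w : is_derive b 1 (F ^~ w) (F' b w).
  by rewrite /F /F'; apply: is_derive_eq; rewrite /GRing.scale/=; ring.
have d1F b w : ((F ^~ w)^`())%classic b = F' b w.
  by rewrite derive1E; exact: derive_val.
(* for 0 < a < 1 and J < 0, |J| e^(-a J) <= e^(|J|) e^(|J|) *)
pose G w := `|J 1 w| + expR (- 2 * J 1 w).
have intG : P.-integrable setT (EFin \o G).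
  have h2 := integrable_expRN (ler0n R 2) ler01.
  have hn := integrable_norm J_integrable.
  apply: eq_integrable (integrableD measurableT hn h2) => //.
have G0 w : 0 <= G w by rewrite addr_ge0// expR_ge0.
have intF b : `]0, 1[%classic b -> P.-integrable setT (EFin \o F b).
  by rewrite /= in_itv/= => /andP[b0 _]; exact: integrable_expRN (ltW b0) ler01.
have Fub b w : 0 < b < 1 -> `|F' b w| <= G w.
  move=> /andP[b0 b1]; rewrite /F' /G normrN normrM (ger0_norm (expR_ge0 _)).
  have [j0|j0] := leP 0 (J 1 w).
    apply: (@le_trans _ _ (`|J 1 w| * 1)); last by rewrite mulr1 lerDl expR_ge0.
    by rewrite ler_wpM2l// -[leRHS]expR0 ler_expR mulNr oppr_le0 mulr_ge0// ltW.
  apply: (@le_trans _ _ (expR (- 2 * J 1 w))); last by rewrite lerDr.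
  have -> : - 2 * J 1 w = - J 1 w + - J 1 w by ring.
  rewrite expRD ler_pM ?expR_ge0//.
    by rewrite ltr0_norm//; apply: le_trans (expR_ge1Dx _); rewrite lerDr.
  rewrite ler_expR mulNr lerN2; have : (1 - b) * J 1 w <= 0 by rewrite nmulr_lle0 // subr_ge0 ltW.
  lra.
have Gub b w : `]0, 1[%classic b -> setT w -> `|partial1of2 F b w| <= G w.
  by rewrite /= in_itv/= => b01 _; rewrite /partial1of2 d1F Fub.
have dF' b w : `]0, 1[%classic b -> setT w -> derivable (F ^~ w) b 1.
  by move=> _ _; exact: ex_derive.
have phiE b : phi b = - ln (\int[P]_w F b w) by rewrite /laplace_exponent unlock.
have dphi b : 0 < b < 1 ->
    phi^`()%classic b = (\int[P]_w (- F' b w)) / (\int[P]_w F b w).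
  move=> b01; have Ib : `]0, 1[%classic b by rewrite /= in_itv.
  have D1 := @derivable_under_integral _ _ _ P F setT measurableT b _ _ Ib intF dF' G G0 intG Gub.
  have D2 := @differentiation_under_integral _ _ _ P F setT measurableT b _ _ Ib intF dF' G G0 intG Gub.
  have [b0 _] := andP b01.
  have M0 : 0 < \int[P]_w F b w.
    by have := laplace_transform_gt0 (ltW b0) ler01.
  have dM : is_derive b 1 (fun x => \int[P]_w F x w) (\int[P]_w F' b w).
    apply: DeriveDef; first exact: D1.
    by rewrite -derive1E D2; apply: eq_Rintegral => w _; rewrite /partial1of2 d1F.
  have dln := is_derive1_comp (is_derive1_ln M0) dM.
  rewrite (_ : phi = - (@ln R \o (fun x => \int[P]_w F x w))); last by apply/funext => x; rewrite phiE.
  rewrite derive1E; have -> := @derive_val _ _ _ _ _ _ _ (is_deriveN dln).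
  rewrite -mulrN mulrC; congr (_ / _).
  have iF' : P.-integrable setT (EFin \o F' b).
    apply: le_integrable intG => //; last by move=> w _ /=; rewrite lee_fin (ger0_norm (G0 w)) Fub.
    apply/measurable_EFinP; apply: measurable_funN; apply: measurable_funM => //.
    by apply: measurableT_comp => //; exact: measurable_funM.
  rewrite /Rintegral -fineN; congr fine.
  rewrite -integralN //; apply: (integrable_add_def measurableT); exact: iF'.
have mF b : measurable_fun setT (F b).
  by apply: measurableT_comp => //; exact: measurable_funM.
have iG' : P.-integrable setT (EFin \o (fun w => 1 + expR (- 1 * J 1 w))).
  have i1 : P.-integrable setT (EFin \o cst (1 : R)) by exact: finite_measure_integrable_cst.
  by apply: eq_integrable (integrableD measurableT i1 (integrable_expRN ler01 ler01)).
have cexp w : (fun a => expR (- a * J 1 w)) a @[a --> 0^'+] --> (1 : R).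
  have : (fun a : R => expR (- a * J 1 w)) a @[a --> (0:R)] --> expR (- 0 * J 1 w).
    apply: continuous_cvg; first exact: continuous_expR.
    by apply: cvgMl; apply: cvgN; exact: cvg_id.
  by rewrite oppr0 mul0r expR0 => /cvg_at_right_filter.
have c1 : \int[P]_w F a w @[a --> 0^'+] --> \int[P]_w (1:R).
  apply: (cvg_at_right0_Rintegral (h := F) _ _ iG') => //.
  move=> a w /andP[a0 a1]; rewrite /F ger0_norm ?expR_ge0//.
  have [j0|j0] := leP 0 (J 1 w).
    apply: (@le_trans _ _ 1); last by rewrite lerDl expR_ge0.
    by rewrite -[leRHS]expR0 ler_expR mulNr oppr_le0 mulr_ge0// ltW.
  apply: (@le_trans _ _ (expR (-1 * J 1 w))); last by rewrite lerDr.
  rewrite ler_expR.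
  have : (1 - a) * J 1 w <= 0 by rewrite nmulr_lle0 // subr_ge0 ltW.
  lra.
have c2 : \int[P]_w (- F' a w) @[a --> 0^'+] --> \int[P]_w J 1 w.
  apply: (cvg_at_right0_Rintegral (h := fun a w => - F' a w) _ _ intG) => //.
  - by move=> a _; rewrite /F'; apply: measurable_funN; apply: measurable_funN;
      apply: measurable_funM => //; exact: mF.
  - move=> w; rewrite /F'; under eq_fun do rewrite opprK.
    have c : J 1 w * expR (- a * J 1 w) @[a --> 0^'+] --> J 1 w * 1.
      by apply: cvgMr; exact: cexp.
    by rewrite mulr1 in c.
  - by move=> a w a01; rewrite normrN Fub.
have I1 : \int[P]_w (1:R) = 1.
  rewrite /Rintegral integral_cst// mul1e.
  by rewrite (_ : fine _ = fine 1%E)//; congr fine; exact: probability_setT.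
rewrite /laplace_exponent_slope0; apply: cvg_lim => //.
rewrite mean_driftE -[X in _ --> X]divr1.
have : (\int[P]_w (- F' a w)) / (\int[P]_w F a w) @[a --> 0^'+] --> \int[P]_w J 1 w / 1.
  by apply: cvgM => //; apply: cvgV; rewrite ?oner_eq0// -[X in _ --> X]I1.
apply: cvg_trans; apply: near_eq_cvg.
near=> a; rewrite dphi//; apply/andP; split; near: a.
- exact: nbhs_right_gt.
- apply: nbhs_right_lt; exact: ltr01.
Unshelve. all: by end_near. Qed.
End moments.

End exponent.

(** * Joint measurability of the path *)

Section joint.
Context {d : measure_display} {Omega : measurableType d} {R : realType}
        (P : probability Omega R) (J : R -> {RV P >-> R}) (LJ : levy_process J).

Lemma levy_right_seq (u : nat -> R) (t : R) w : 0 <= t -> (forall n, t <= u n) ->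
  u n @[n --> \oo] --> t -> J (u n) w @[n --> \oo] --> J t w.
Proof.
move=> t0 tu ut; apply/cvgrPdist_lt => e e0.
have /cvgrPdist_lt /(_ e e0) := @levy_right_continuous _ _ _ _ _ LJ w t t0.
rewrite near_withinE near_simpl => /nbhs_ballP[r /= r0 hr].
move/cvgrPdist_lt : ut => /(_ r r0); apply: filterS => n hn.
have [<-|tn] := eqVneq t (u n); first by rewrite subrr normr0.
by apply: hr => //; rewrite lt_neqAle tn tu.
Qed.

(** The path extended by its value at 0 to negative times, at which the process is
    unconstrained; the extension is jointly measurable. *)
Definition Jpos (z : Omega * measurableTypeR R) : R := J (Num.max 0 z.2) z.1.

Let grid_up (n : nat) (t : R) : R := (Num.truncn (2 ^+ n * Num.max 0 t)).+1%:R / 2 ^+ n.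

(** By right-continuity Jpos is the limit of its values at the next dyadic time,
    which takes countably many values. *)
Lemma measurable_Jpos : measurable_fun setT Jpos.
Proof.
pose F n (z : Omega * measurableTypeR R) : R := J (grid_up n z.2) z.1.
apply: (@measurable_fun_cvg _ _ _ _ F) => [n|z _]; last first.
  have m0 : 0 <= Num.max 0 z.2 by rewrite le_max lexx.
  apply: levy_right_seq => //.
    move=> n; rewrite /grid_up ler_pdivlMr ?exprn_gt0// mulrC ltW//.
    by have := truncnS_gt (2 ^+ n * Num.max 0 z.2).
  rewrite /grid_up; apply/cvgrPdist_le => e e0.
  have : \forall n \near \oo, 2^-1 ^+ n <= e.
    have h : `|2^-1 : R| < 1 by rewrite ger0_norm ?invr_ge0// invf_lt1// ltr1n.
    have /cvgrPdist_le /(_ e e0) := cvg_expr h.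
    by apply: filterS => n; rewrite sub0r normrN ger0_norm// exprn_ge0// invr_ge0.
  apply: filterS => n hn; apply: le_trans hn.
  have p0 : 0 < 2 ^+ n :> R by rewrite exprn_gt0.
  have /andP[h1 h2] := truncn_itv (mulr_ge0 (ltW p0) m0).
  move: h1 h2; set p := 2 ^+ n in p0 *; set m := Num.max 0 z.2; set k := Num.truncn _ => h1 h2.
  have -> : m - k.+1%:R / p = (p * m - k.+1%:R) / p by field; rewrite gt_eqF.
  have pV : 0 < p^-1 by rewrite invr_gt0.
  rewrite exprVn normrM (ger0_norm (ltW pV)) -[X in _ <= X]mul1r (ler_pM2r pV).
  by rewrite ler_norml -natr1; move: h2; rewrite -natr1 => h2; apply/andP; split; lra.
move=> _ A mA; rewrite setTI.
pose c k : R := k.+1%:R / 2 ^+ n.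
have -> : F n @^-1` A = \bigcup_k ((J (c k) @^-1` A) `*`
   ((fun t : measurableTypeR R => 2 ^+ n * Num.max 0 t) @^-1` `[k%:R, k.+1%:R[)).
  apply/seteqP; split=> [[w t] /= h|[w t] [k _ [/= h1]]].
    exists (Num.truncn (2 ^+ n * Num.max 0 t)) => //; split => //=.
    rewrite in_itv/=; apply: truncn_itv; rewrite mulr_ge0 ?exprn_ge0// le_max lexx//.
  rewrite in_itv/= => h2; rewrite /F /grid_up /= (_ : Num.truncn _ = k)//.
  by apply: truncn_def.
apply: bigcup_measurable => k _; apply: measurableX.
  by rewrite -[X in measurable X]setTI; exact: measurable_funPT.
rewrite -[X in measurable X]setTI; apply: (measurable_funM (measurable_cst _) _) => //.
by apply: measurable_maxr.
Qed.
End joint.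

(** * The walk on a grid, stopped at its exit from the positive half-line *)

Section grid.
Context {d : measure_display} {Omega : measurableType d} {R : realType}
        (P : probability Omega R) (J : R -> {RV P >-> R}).
Implicit Types (x h a : R) (k j K : nat) (w : Omega).

Definition alive h x k w : bool := all (fun j => 0 < x + J (j%:R * h) w) (iota 0 k.+1).

(** Equals K when the walk stays positive at all the steps before K. *)
Definition exit_step h x K w : nat := find (fun j => x + J (j%:R * h) w <= 0) (iota 0 K).

Lemma aliveP h x k w : reflect (forall j, (j <= k)%N -> 0 < x + J (j%:R * h) w) (alive h x k w).
Proof.
apply: (iffP allP) => [al j jk|al j]; first by apply: al; rewrite mem_iota.
by rewrite mem_iota/= ltnS => /al.
Qed.

Lemma exit_step_le h x K w : (exit_step h x K w <= K)%N.
Proof. by rewrite -[leqRHS](size_iota 0 K); exact: find_size. Qed.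

Lemma exit_stepP h x K w : (exit_step h x K w < K)%N ->
  x + J ((exit_step h x K w)%:R * h) w <= 0.
Proof.
move=> lt; have := @nth_find _ 0%N (fun j => x + J (j%:R * h) w <= 0) (iota 0 K).
by rewrite has_find size_iota nth_iota// add0n => /(_ lt).
Qed.

(** Both sides say that no step up to k is nonpositive. *)
Lemma alive_exit_step h x K k w : (k < K)%N -> alive h x k w = (k < exit_step h x K w)%N.
Proof.
move=> kK; apply/aliveP/idP => [al|lt j jk].
  rewrite ltnNge; apply/negP => le.
  have := exit_stepP (leq_ltn_trans le kK); rewrite leNgt => /negP; apply; exact: al.
have jl := leq_ltn_trans jk lt.
have := @before_find _ 0%N (fun j => x + J (j%:R * h) w <= 0) (iota 0 K) j jl.
rewrite nth_iota ?add0n; last exact: leq_trans jl (exit_step_le _ _ _ _).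
by move/negbT; rewrite -ltNge.
Qed.

(** u r = u 0 + sum of the increments of u before r, written with sums of
    nonnegative terms on both sides so that it can be integrated in the extended
    reals. *)
Lemma stopped_telescope (u : nat -> R) r K : (r <= K)%N ->
  u r + \sum_(k < K) (k < r)%N%:R * u k = u 0%N + \sum_(k < K) (k < r)%N%:R * u k.+1.
Proof.
move=> rK; suff : \sum_(k < K) (k < r)%N%:R * (u k.+1 - u k) = u r - u 0%N.
  under eq_bigr do rewrite mulrBr.
  by rewrite sumrB => h; lra.
elim: K r rK => [|K IH] r; first by rewrite leqn0 => /eqP ->; rewrite big_ord0 subrr.
rewrite leq_eqVlt big_ord_recr /= => /predU1P[->|rK].
  rewrite leqnn mul1r (eq_bigr (fun k : 'I_K => (k < K)%N%:R * (u k.+1 - u k))).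
    rewrite IH//; lra.
  by move=> k _; rewrite ltn_ord (ltn_trans (ltn_ord k)).
rewrite IH//; have -> : (K < r)%N = false by apply/negbTE; rewrite -leqNgt.
by rewrite mul0r addr0.
Qed.

Lemma measurable_all_gt d' (T : measurableType d') (Y : nat -> T -> R) (s : seq nat) :
  (forall j, j \in s -> measurable_fun setT (Y j)) ->
  measurable_fun setT (fun w : T => (all (fun j => 0 < Y j w) s)%:R : R).
Proof.
elim: s => [|j s IH] mY; first exact: measurable_cst.
rewrite (_ : (fun w : T => _) =
    (fun w : T => (\1_(Y j @^-1` `]0, +oo[) w) * (all (fun j => 0 < Y j w) s)%:R)).
  apply: measurable_funM; last by apply: IH => i si; apply: mY; rewrite inE si orbT.
  apply: measurable_indic; rewrite -[X in measurable X]setTI.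
  by apply: mY => //; rewrite inE eqxx.
apply/funext => w; rewrite /= -mulnb natrM; congr (_ * _).
by rewrite indicE; congr (nat_of_bool _)%:R; apply/idP/idP; rewrite inE/= in_itv/= andbT.
Qed.

Variable sigma : R.
Hypothesis hJ : subordinator_plus_brownian sigma J.
Let LJ : levy_process J := hJ.1.
Local Notation phi := (laplace_exponent J).

Definition expW a x (t : R) w : R := expR (- a * (x + J t w)).

Lemma measurable_expW a x t : measurable_fun setT (expW a x t).
Proof.
by apply: measurableT_comp => //; apply: measurable_funM => //; exact: measurable_funD.
Qed.

Lemma expectation_expW a x t : 0 <= a -> 0 <= t ->
  (\int[P]_w (expW a x t w)%:E = (expR (- a * x - phi a * t))%:E)%E.
Proof.
move=> a0 t0; rewrite /expW.
under eq_integral do rewrite mulrDr expRD EFinM.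
rewrite ge0_integralZl//.
- by rewrite (exp_moment hJ)// -EFinM -expRD; congr (expR _)%:E; ring.
- by apply/measurable_EFinP; apply: measurableT_comp => //; exact: measurable_funM.
Qed.

Lemma measurable_alive h x k : measurable_fun setT (fun w => (alive h x k w)%:R : R).
Proof. by apply: measurable_all_gt => j _; exact: measurable_funD. Qed.

Definition alive_mass a x h k : \bar R :=
  (\int[P]_w ((alive h x k w)%:R * expW a x (k%:R * h) w)%:E)%E.

(** Being alive at step k and the position there are functions of the past, so the
    later increment contributes the factor E e^(-a J_s). *)
Lemma alive_mass_step a x h k (s : R) : 0 <= a -> 0 <= h -> 0 <= s ->
  (\int[P]_w ((alive h x k w)%:R * expW a x (k%:R * h + s) w)%:E =
   alive_mass a x h k * (expR (- phi a * s))%:E)%E.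
Proof.
move=> a0 h0 s0; pose t i : R := i%:R * h.
have mE : measurable_fun setT (fun y : R => expR (- a * y)).
  by apply: measurableT_comp => //; exact: measurable_funM.
have nt i : t i <= t i.+1 by rewrite /t ler_wpM2r// ler_nat.
have t0 : t 0%N = 0 by rewrite /t mul0r.
have mJ j : (j <= k)%N -> measurable_fun setT ((fun w => x + J (t j) w) : g_sigma_algebraType (past J t k) -> R).
  by move=> jk; apply: measurable_funD => //; exact: measurable_past.
rewrite -(exp_moment hJ)// /alive_mass.
rewrite -(@levy_markov _ _ _ _ _ LJ t k s (fun w => (alive h x k w)%:R * expW a x (t k) w)
  (fun y => expR (- a * y)))//.
- apply: eq_integral => w _; congr EFin; rewrite -mulrA /expW -expRD.
  by congr (_ * expR _); rewrite /increment /t; ring.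
- apply: measurable_funM.
    apply: (@measurable_all_gt _ (g_sigma_algebraType (past J t k)) (fun j w => x + J (t j) w)) => j.
    by rewrite mem_iota/= ltnS => /mJ.
  by apply: (measurableT_comp mE); exact: mJ.
- by move=> w; rewrite mulr_ge0// expR_ge0.
Qed.

Lemma alive_mass_ge0 a x h k : (0 <= alive_mass a x h k)%E.
Proof. by apply: integral_ge0 => w _; rewrite lee_fin mulr_ge0// expR_ge0. Qed.

Lemma alive_mass_le a x h k : 0 <= a -> 0 <= h ->
  (alive_mass a x h k <= (expR (- a * x - phi a * (k%:R * h)))%:E)%E.
Proof.
move=> a0 h0; rewrite -expectation_expW//; last exact: mulr_ge0.
apply: ge0_le_integral => //.
- by move=> w _; rewrite lee_fin mulr_ge0// expR_ge0.
- apply/measurable_EFinP; apply: measurable_funM; first exact: measurable_alive.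
  exact: measurable_expW.
- by apply/measurable_EFinP; exact: measurable_expW.
- by move=> w _; rewrite lee_fin ler_piMl ?expR_ge0//; case: alive.
Qed.

Lemma alive_mass_fin a x h k : 0 <= a -> 0 <= h -> alive_mass a x h k \is a fin_num.
Proof.
move=> a0 h0; rewrite ge0_fin_numE ?alive_mass_ge0//.
exact: le_lt_trans (alive_mass_le _ _ a0 h0) (ltry _).
Qed.

Definition exit_expW a x h K w : R := expW a x ((exit_step h x K w)%:R * h) w.

Lemma exit_expWE a x h K w :
  exit_expW a x h K w + \sum_(k < K) (alive h x k w)%:R * expW a x (k%:R * h) w =
  expW a x 0 w + \sum_(k < K) (alive h x k w)%:R * expW a x (k.+1%:R * h) w.
Proof.
have := @stopped_telescope (fun k => expW a x (k%:R * h) w) _ _ (exit_step_le h x K w).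
rewrite mul0r => e; rewrite /exit_expW.
under eq_bigr do rewrite (alive_exit_step _ _ _ (ltn_ord _)).
under [in RHS]eq_bigr do rewrite (alive_exit_step _ _ _ (ltn_ord _)).
exact: e.
Qed.

Lemma measurable_exit_expW a x h K : measurable_fun setT (exit_expW a x h K).
Proof.
rewrite (_ : exit_expW a x h K = fun w =>
  expW a x 0 w + \sum_(k < K) (alive h x k w)%:R * expW a x (k.+1%:R * h) w -
  \sum_(k < K) (alive h x k w)%:R * expW a x (k%:R * h) w); last first.
  by apply/funext => w; rewrite -exit_expWE addrK.
apply: measurable_funB; first (apply: measurable_funD; first exact: measurable_expW).
  apply: measurable_sum => k; apply: measurable_funM; first exact: measurable_alive.
  exact: measurable_expW.
apply: measurable_sum => k; apply: measurable_funM; first exact: measurable_alive.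
exact: measurable_expW.
Qed.

(** The discrete counterpart of optional stopping: each step survived multiplies
    the expected exponential by e^(-phi(a) h). *)
Lemma expectation_exit_expW a x h K : 0 <= a -> 0 <= h ->
  (\int[P]_w (exit_expW a x h K w)%:E =
   (expR (- a * x) + \sum_(k < K) fine (alive_mass a x h k) * (expR (- phi a * h) - 1))%:E)%E.
Proof.
move=> a0 h0; pose c k := fine (alive_mass a x h k).
have cE k : alive_mass a x h k = (c k)%:E by rewrite fineK// alive_mass_fin.
have mA k t : measurable_fun setT (fun w => ((alive h x k w)%:R * expW a x t w)%:E).
  apply/measurable_EFinP; apply: measurable_funM; first exact: measurable_alive.
  exact: measurable_expW.
have A0 k t w : (0 <= ((alive h x k w)%:R * expW a x t w)%:E)%E.
  by rewrite lee_fin mulr_ge0// expR_ge0.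
have : (\int[P]_w (exit_expW a x h K w + \sum_(k < K) (alive h x k w)%:R * expW a x (k%:R * h) w)%:E
     = \int[P]_w (expW a x 0 w + \sum_(k < K) (alive h x k w)%:R * expW a x (k.+1%:R * h) w)%:E)%E.
  by apply: eq_integral => w _; rewrite exit_expWE.
under eq_integral do rewrite EFinD -sumEFin.
under [X in _ = X -> _]eq_integral do rewrite EFinD -sumEFin.
rewrite ge0_integralD//; last 4 first.
- by move=> w _; rewrite lee_fin expR_ge0.
- by apply/measurable_EFinP; exact: measurable_exit_expW.
- by move=> w _; exact: sume_ge0.
- by apply: emeasurable_sum => k.
rewrite ge0_integralD//; last 4 first.
- by move=> w _; rewrite lee_fin expR_ge0.
- by apply/measurable_EFinP; exact: measurable_expW.
- by move=> w _; exact: sume_ge0.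
- by apply: emeasurable_sum => k.
have S (u : nat -> R) : (\int[P]_w (\sum_(k < K) ((alive h x k w)%:R * expW a x (u k) w)%:E) =
    \sum_(k < K) \int[P]_w ((alive h x k w)%:R * expW a x (u k) w)%:E)%E.
  by apply: ge0_integral_sum => [|k|k w _]; [exact: measurableT|exact: mA|exact: A0].
rewrite (S (fun k => k%:R * h)) (S (fun k => k.+1%:R * h)).
rewrite (expectation_expW x a0 (lexx 0)) mulr0 subr0.
rewrite (eq_bigr (fun k : 'I_K => (c k)%:E)); last by move=> k _; rewrite -cE.
rewrite [in RHS](eq_bigr (fun k : 'I_K => (c k * expR (- phi a * h))%:E)); last first.
  by move=> k _; rewrite -natr1 mulrDl mul1r alive_mass_step// cE EFinM.
rewrite !sumEFin => e.
have -> : (\int[P]_w (exit_expW a x h K w)%:E)%E =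
    ((expR (- a * x))%:E + (\sum_(i < K) c i * expR (- phi a * h))%:E - (\sum_(i < K) c i)%:E)%E.
  by rewrite -e addeK.
transitivity ((expR (- a * x) + \sum_(i < K) c i * expR (- phi a * h) - \sum_(i < K) c i)%:E).
  by rewrite EFinB EFinD.
congr EFin; rewrite -addrA -sumrB; congr (_ + _).
by apply: eq_bigr => k _; rewrite mulrBr mulr1.
Qed.

(** For phi(a) <= 0 the exponential is a submartingale, so stopping it before the
    horizon does not increase its expectation. *)
Lemma expectation_exit_expW_le a x h K : 0 <= a -> 0 <= h -> phi a <= 0 ->
  (\int[P]_w (exit_expW a x h K w)%:E <= (expR (- a * x - phi a * (K%:R * h)))%:E)%E.
Proof.
move=> a0 h0 p0; rewrite expectation_exit_expW// lee_fin.
elim: K => [|K IH]; first by rewrite big_ord0 mul0r mulr0 subr0 addr0.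
rewrite big_ord_recr /= addrA.
have q1 : 1 <= expR (- phi a * h) by rewrite -expR0 ler_expR mulNr oppr_ge0 mulr_le0_ge0.
have hK : fine (alive_mass a x h K) <= expR (- a * x - phi a * (K%:R * h)).
  by rewrite -lee_fin fineK ?alive_mass_fin// alive_mass_le.
have -> : - a * x - phi a * (K.+1%:R * h) = (- a * x - phi a * (K%:R * h)) + (- phi a * h).
  by rewrite -natr1; ring.
rewrite expRD; have := ler_wpM2r (_ : 0 <= expR (- phi a * h) - 1) hK.
rewrite subr_ge0 => /(_ q1); lra.
Qed.
End grid.

(** * Occupation measure of the stopped walk *)

Section occupation.
Context {d : measure_display} {Omega : measurableType d} {R : realType}
        (P : probability Omega R) (J : R -> {RV P >-> R}).
Variable sigma : R.
Hypothesis hJ : subordinator_plus_brownian sigma J.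
Implicit Types (x h a : R) (k j K : nat) (w : Omega).
Local Notation phi := (laplace_exponent J).
Local Notation T := (Omega * measurableTypeR R)%type.
Local Notation mu := (P \x (@lebesgue_measure R))%E.

Lemma integral_expR_itv (p u v : R) : p != 0 -> u < v ->
  (\int[lebesgue_measure]_(t in `[u, v[) (expR (- p * (t - u)))%:E =
   ((expR (- p * (v - u)) - 1) / - p)%:E)%E.
Proof.
move=> p0 uv; rewrite integral_itv_bndo_bndc; last first.
  apply/measurable_EFinP; apply: measurableT_comp => //; apply: measurable_funM => //.
  exact: measurable_funB.
pose F (t : R) := expR (- p * (t - u)) / - p.
have dF (t : R) : is_derive t 1 F (expR (- p * (t - u))).
  rewrite /F; apply: is_derive_eq; rewrite /GRing.scale/=; field; exact: p0.
have cF (t : R) : {for t, continuous F}.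
  by apply: differentiable_continuous; apply/derivable1_diffP; exact: ex_derive.
rewrite (@continuous_FTC2 _ _ F _ _ uv).
- by rewrite /F subrr mulr0 expR0 -EFinB mulrBl.
- apply: continuous_subspaceT => t.
  have dE : is_derive t 1 (fun t => expR (- p * (t - u))) (- p * expR (- p * (t - u))).
    by apply: is_derive_eq; rewrite /GRing.scale/=; ring.
  by apply: differentiable_continuous; apply/derivable1_diffP; exact: ex_derive.
- split => [t _| |]; first exact: ex_derive.
  + exact: cvg_at_right_filter (cF u).
  + exact: cvg_at_left_filter (cF v).
- by move=> t _; rewrite derive1E; exact: derive_val.
Qed.

(** Positivity is required at the times of Q up to t only: for countable Q this is a
    measurable set, unlike a condition on all times. *)
Definition alive_set (Q : set R) x : set T :=
  [set z | 0 <= z.2 /\ forall q, Q q -> q <= z.2 -> 0 < x + J q z.1].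

Definition grid h : set R := range (fun j => j%:R * h).

(** Countable intersection of the conditions: t < q n or x + J (q n) > 0. *)
Lemma measurable_alive_set (q : nat -> R) x : measurable (alive_set (range q) x).
Proof.
have -> : alive_set (range q) x = (@snd Omega (measurableTypeR R) @^-1` `[0, +oo[) `&`
   \bigcap_n ((@snd Omega (measurableTypeR R) @^-1` `]-oo, q n[) `|`
     (((J (q n) : Omega -> R) @^-1` `]- x, +oo[) `*` setT)).
  apply/seteqP; split => [[w t] [/= t0 al]|[w t] /= [t0 al]].
    split; first by rewrite /= in_itv/= t0.
    move=> n _ /=; rewrite !in_itv/= andbT.
    case: (ltP t (q n)) => h; [by left|right; split => //].
    by have := al (q n) (ex_intro2 _ _ n Logic.I erefl) h; lra.
  split; first by move: t0; rewrite in_itv/= andbT.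
  move=> _ [n _ <-] qt; have /= := al n Logic.I; rewrite !in_itv/= andbT => -[|[]].
    by rewrite ltNge qt.
  by move=> h _; lra.
apply: measurableI.
  by rewrite -[X in measurable X]setTI; apply: measurable_snd.
apply: bigcap_measurableType => n _; apply: measurableU.
  by rewrite -[X in measurable X]setTI; apply: measurable_snd.
apply: measurableX => //.
by rewrite -[X in measurable X]setTI; exact: measurable_funPT.
Qed.

Lemma alive_set_grid h x k w (t : R) : 0 < h -> k%:R * h <= t < k.+1%:R * h ->
  alive_set (grid h) x (w, t) <-> alive J h x k w.
Proof.
move=> h0 /andP[kt tk]; split => [[/= t0 al]|/aliveP al].
  apply/aliveP => j jk; apply: al; first by exists j.
  by apply: le_trans kt; rewrite ler_pM2r// ler_nat.
split => /=; first by apply: le_trans kt; rewrite mulr_ge0// ltW.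
move=> _ [j _ <-] jt; apply: al.
have := le_lt_trans jt tk; rewrite ltr_pM2r// ltr_nat ltnS//.
Qed.

Definition alive_before (Q : set R) x (u : R) : set T :=
  alive_set Q x `&` (snd @^-1` `[0, u[%classic).

Lemma measurable_alive_before (q : nat -> R) x u : measurable (alive_before (range q) x u).
Proof.
apply: measurableI; first exact: measurable_alive_set.
by rewrite -[X in measurable X]setTI; apply: measurable_snd.
Qed.

Definition expJ a x (z : T) : R := expR (- a * (x + Jpos J z)).

Lemma measurable_expJ a x : measurable_fun setT (expJ a x).
Proof.
apply: measurableT_comp => //; apply: measurable_funM => //; apply: measurable_funD => //.
exact: (measurable_Jpos hJ.1).
Qed.

(** Tonelli, then on each mesh interval being alive is decided at its left end, and
    the expectation of the exponential at a later time t of the interval is the one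
    at the left end times e^(-phi(a) (t - k h)). *)
Lemma occupation_grid a x h K : 0 <= a -> 0 < h -> phi a != 0 ->
  (\int[mu]_(z in alive_before (grid h) x (K%:R * h)) (expJ a x z)%:E =
   (\sum_(k < K) fine (alive_mass J a x h k) * ((expR (- phi a * h) - 1) / - phi a))%:E)%E.
Proof.
move=> a0 h0 p0; set D := alive_before _ _ _.
have mD : measurable D by exact: measurable_alive_before.
pose f := (fun z => (expJ a x z)%:E) \_ D.
have f0 z : (0 <= f z)%E by rewrite /f patchE; case: ifP => // _; rewrite lee_fin expR_ge0.
have mf : measurable_fun setT f.
  apply/(measurable_restrictT _ _).1 => //.
  by apply/measurable_EFinP; apply: measurable_funTS; exact: measurable_expJ.
rewrite integral_mkcond fubini_tonelli2//.
pose G := fubini_G P f.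
have mG : measurable_fun setT G by exact: measurable_fun_fubini_tonelli_G.
have G0 t : (0 <= G t)%E by exact: integral_ge0.
have GE k t : (k < K)%N -> k%:R * h <= t < k.+1%:R * h ->
    G t = ((fine (alive_mass J a x h k))%:E * (expR (- phi a * (t - k%:R * h)))%:E)%E.
  move=> kK kt; have /andP[kt1 kt2] := kt.
  have t0 : 0 <= t by apply: le_trans kt1; rewrite mulr_ge0// ltW.
  rewrite fineK; last by apply: (alive_mass_fin hJ) => //; exact: ltW.
  rewrite -(alive_mass_step hJ)// ?subr_ge0// ?(ltW h0)//.
  apply: eq_integral => w _; rewrite /f patchE /expJ /Jpos/= max_r// subrKC.
  have [al|nal] := boolP (alive J h x k w).
    rewrite mul1r mem_set//; split; first exact/(alive_set_grid _ _ h0 kt).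
    by rewrite /= in_itv/= t0; apply: lt_le_trans kt2 _; rewrite ler_pM2r// ler_nat.
  rewrite mul0r ifF//; apply/negP; rewrite inE => -[/(alive_set_grid _ _ h0 kt) al _].
  by rewrite al in nal.
have GD : G = G \_ `[0, K%:R * h[.
  apply/funext => t; rewrite patchE; case: ifPn => // /negP tn.
  rewrite /G /fubini_G integral0_eq// => w _; rewrite /f patchE memNset// => -[_ /= h1].
  by apply: tn; rewrite inE.
rewrite -/G GD -integral_mkcond.
suff : forall m, (m <= K)%N -> (\int[lebesgue_measure]_(t in `[0%R, (m%:R * h)%R[) G t =
   (\sum_(k < m) fine (alive_mass J a x h k) * ((expR (- phi a * h) - 1) / - phi a))%:E)%E.
  exact.
elim => [_|m IH mK]; first by rewrite big_ord0 mul0r set_itvco0 integral_set0.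
have mh : m%:R * h < m.+1%:R * h by rewrite ltr_pM2r// ltr_nat.
have mh0 : 0 <= m%:R * h by rewrite mulr_ge0// ltW.
have -> : `[0, m.+1%:R * h[%classic = `[0, m%:R * h[%classic `|` `[m%:R * h, m.+1%:R * h[%classic.
  by rewrite -(itv_bndbnd_setU (x := BLeft (m%:R * h)))// bnd_simp// ltW.
rewrite ge0_integral_setU//=; last 2 first.
- exact: measurable_funTS.
- apply/disj_setPS => t [/=]; rewrite !in_itv/= => /andP[_ h1] /andP[h2 _].
  by move: h1; rewrite ltNge h2.
rewrite IH ?(ltnW mK)// big_ord_recr /= EFinD; congr (_ + _)%E.
transitivity (\int[lebesgue_measure]_(t in `[(m%:R * h)%R, (m.+1%:R * h)%R[)
   ((fine (alive_mass J a x h m))%:E * (expR (- phi a * (t - m%:R * h)))%:E))%E.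
  apply: eq_integral.
  by move=> t; rewrite inE/= in_itv/= => ht; exact: GE.
rewrite ge0_integralZl//.
- rewrite integral_expR_itv// -EFinM -mulrBl -natrB// subSnn mul1r//.
- apply/measurable_EFinP; apply: measurableT_comp => //; apply: measurable_funM => //.
  exact: measurable_funB.
- by rewrite lee_fin fine_ge0// alive_mass_ge0.
Qed.

(** The occupation integral collects the factors by which the stopped walk misses
    being a martingale. This is the identity of Kella and Whitt for the walk on the
    grid, and it is exact for every mesh. *)
Lemma exit_occupation a x h K : 0 <= a -> 0 < h -> phi a != 0 ->
  (\int[P]_w (exit_expW J a x h K w)%:E = (expR (- a * x))%:E +
    (- phi a)%:E * \int[mu]_(z in alive_before (grid h) x (K%:R * h)) (expJ a x z)%:E)%E.
Proof.
move=> a0 h0 p0; rewrite occupation_grid// (expectation_exit_expW hJ) ?(ltW h0)//.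
rewrite -EFinM -EFinD; congr (_ + _)%:E; rewrite mulr_sumr; apply: eq_bigr => k _.
by field.
Qed.
End occupation.

(** * Paths whose jumps are all upward *)

Section paths.
Context {d : measure_display} {Omega : measurableType d} {R : realType}
        (P : probability Omega R) (J : R -> {RV P >-> R}).
Variable sigma : R.
Hypothesis hJ : subordinator_plus_brownian sigma J.
Let LJ : levy_process J := hJ.1.
Implicit Types (x : R) (n k j N : nat) (w : Omega).

Lemma path_decomposition w : exists S B : R -> R,
  [/\ (forall s t, 0 <= s -> s <= t -> S s <= S t),
      {within `[0, +oo[, continuous B} &
      forall t, 0 <= t -> J t w = S t + B t].
Proof.
case: hJ => _ [b [S [B [[LS Smon] [W [hW BE]] _ JE]]]].
exists (fun t => S t w), (fun t => b * t + sigma * W t w); split.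
- by move=> s t; exact: Smon.
- have [s0|s0] := eqVneq sigma 0.
    apply: continuous_subspaceT => t; rewrite s0.
    under eq_fun do rewrite mul0r addr0.
    by apply: cvgMr; exact: cvg_id.
  have cW := @brownian_continuous _ _ _ _ _ (hW s0) w.
  move=> t; apply: cvgD.
    by apply: continuous_subspaceT => {}t; apply: cvgMr; exact: cvg_id.
  by apply: cvgMr; exact: cW.
- by move=> t t0; rewrite JE// BE.
Qed.

(** An upward jump at t leaves J_t above its left limit: the nondecreasing part S
    satisfies S (q n) <= S t and the other part is continuous. *)
Lemma path_lower_limit x w (t : R) (q : nat -> R) :
  (forall n, 0 <= q n <= t) -> q n @[n --> \oo] --> t ->
  (forall n, 0 <= x + J (q n) w) -> 0 <= x + J t w.
Proof.
move=> q0t qt Jq; have [S [B [Smon cB JE]]] := path_decomposition w.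
have t0 : 0 <= t by have /andP[h1 h2] := q0t 0%N; exact: le_trans h2.
have Bq : B (q n) @[n --> \oo] --> B t.
  have /subspace_continuousP /(_ t) := cB; rewrite /= in_itv/= t0 => /(_ isT) h.
  apply: (cvg_trans _ h) => A [e /= e0 eA].
  move/cvgrPdist_lt : qt => /(_ e e0); apply: filterS => n hn.
  by apply: eA => //=; rewrite in_itv/= andbT; have /andP[] := q0t n.
have c : x + S t + B (q n) @[n --> \oo] --> x + S t + B t by apply: cvgD => //; exact: cvg_cst.
rewrite JE// addrA -(cvg_lim _ c)//; apply: limr_ge; first by apply/cvg_ex; eexists; exact: c.
apply: nearW => n; have /andP[h1 h2] := q0t n; apply: le_trans (Jq n) _.
by rewrite JE// addrA lerD2r lerD2l; exact: Smon.
Qed.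

Definition mesh n : R := (2 ^+ n)^-1.

Lemma mesh_gt0 n : 0 < mesh n. Proof. by rewrite invr_gt0 exprn_gt0. Qed.

Lemma meshS n : mesh n = 2 * mesh n.+1.
Proof. by rewrite /mesh exprS invfM mulrA divff ?mul1r// pnatr_eq0. Qed.

Lemma cvg_mesh : mesh n @[n --> \oo] --> 0.
Proof.
have h : `|2^-1 : R| < 1 by rewrite ger0_norm ?invr_ge0// invf_lt1// ltr1n.
have := cvg_expr h; apply: cvg_trans; apply: near_eq_cvg; apply: nearW => n.
by rewrite /mesh exprVn.
Qed.

(** Number of steps of mesh 2^-n up to the horizon N. *)
Definition steps N n : nat := (N * 2 ^ n)%N.

Lemma steps_mesh N n : (steps N n)%:R * mesh n = N%:R.
Proof. by rewrite /steps natrM natrX mulfK// expf_neq0// pnatr_eq0. Qed.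

Definition exit_time x N n w : R := (exit_step J (mesh n) x (steps N n) w)%:R * mesh n.

Lemma exit_time_ge0 x N n w : 0 <= exit_time x N n w.
Proof. by rewrite mulr_ge0// ltW// mesh_gt0. Qed.

(** The coarser grid is part of the finer one, so the finer walk exits no later. *)
Lemma exit_time_nonincreasing x N w : nonincreasing_seq (exit_time x N ^~ w).
Proof.
apply/nonincreasing_seqP => n; rewrite /exit_time; set e := exit_step J (mesh n) _ _ _.
have -> : e%:R * mesh n = (e * 2)%N%:R * mesh n.+1 by rewrite natrM -mulrA -meshS.
rewrite ler_pM2r ?mesh_gt0// ler_nat.
have := exit_step_le J (mesh n) x (steps N n) w; rewrite -/e leq_eqVlt => /predU1P[eE|eK].
  by rewrite eE (leq_trans (exit_step_le _ _ _ _ _))// /steps expnSr mulnA.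
have Je := exit_stepP eK; rewrite -/e in Je.
rewrite leqNgt; apply/negP => lt.
have e2 : (e * 2 < steps N n.+1)%N by rewrite /steps expnS mulnCA mulnC ltn_pmul2l.
have := alive_exit_step J (mesh n.+1) x w e2; rewrite lt => /aliveP /(_ _ (leqnn _)).
by rewrite natrM -mulrA -meshS ltNge Je.
Qed.

Lemma alive_before_exit x N n j w : j%:R * mesh n < exit_time x N n w ->
  0 < x + J (j%:R * mesh n) w.
Proof.
rewrite /exit_time ltr_pM2r ?mesh_gt0// ltr_nat => lt.
have jK : (j < steps N n)%N by apply: leq_trans lt (exit_step_le _ _ _ _ _).
by have := alive_exit_step J (mesh n) x w jK; rewrite lt => /aliveP /(_ _ (leqnn _)).
Qed.

(** The exit times decrease to some t, and right-continuity gives convergence of J.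
    All grid times before t are alive, so W >= 0 at t by path_lower_limit. *)
Lemma exit_time_cvg x N w : 0 < x -> exists2 t : R, 0 <= t /\ 0 <= x + J t w &
  J (exit_time x N n w) w @[n --> \oo] --> J t w.
Proof.
move=> x0; have nD := exit_time_nonincreasing x N w.
have lb : has_lbound (range (exit_time x N ^~ w)).
  by exists 0 => _ [n _ <-]; exact: exit_time_ge0.
have cD := nonincreasing_is_cvgn nD lb.
set t := limn (exit_time x N ^~ w).
have tD n : t <= exit_time x N n w by exact: nonincreasing_cvgn_ge.
have t0 : 0 <= t by apply: limr_ge => //; apply: nearW => n; exact: exit_time_ge0.
exists t; last exact: levy_right_seq.
split => //; have [te0|tn0] := eqVneq t 0; first by rewrite te0 (levy0 LJ) addr0 ltW.
have tpos : 0 < t by rewrite lt_neqAle eq_sym tn0.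
(* the last grid point up to t may be t itself, which can be the exit time: one
   step back stays strictly before t *)
pose q n : R := (Num.truncn (2 ^+ n * t)).-1%:R * mesh n.
have qt n : q n < t.
  have p0 : 0 < 2 ^+ n :> R by rewrite exprn_gt0.
  rewrite /q /mesh ltr_pdivrMr// [ltRHS]mulrC.
  have /andP[h1 _] := truncn_itv (mulr_ge0 (ltW p0) t0).
  case: (Num.truncn _) h1 => [|k] h1; first by rewrite /= mulr_gt0.
  by apply: lt_le_trans h1; rewrite ltr_nat.
apply: (@path_lower_limit x w t q) => [n||n].
- by rewrite (ltW (qt n)) andbT mulr_ge0// ltW// mesh_gt0.
- have c : t - 2 * mesh n @[n --> \oo] --> t.
    have : t - 2 * mesh n @[n --> \oo] --> t - 2 * 0.
      by apply: cvgB; [exact: cvg_cst|apply: cvgMr; exact: cvg_mesh].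
    by rewrite mulr0 subr0.
  apply: (@squeeze_cvgr _ _ _ _ (fun n => t - 2 * mesh n) (cst t)) => //; last exact: cvg_cst.
  apply: nearW => n; rewrite (ltW (qt n)) andbT /q.
  have p0 : 0 < 2 ^+ n :> R by rewrite exprn_gt0.
  have /andP[_ h2] := truncn_itv (mulr_ge0 (ltW p0) t0).
  rewrite lerBlDr /mesh -mulrDl ler_pdivlMr// mulrC; apply: le_trans (ltW h2) _.
  by rewrite -natrD ler_nat; case: (Num.truncn _) => //= k; rewrite addn2.
- by apply: ltW; apply: (@alive_before_exit x N n); apply: lt_le_trans (qt n) (tD n).
Qed.
End paths.

(** * The Laplace transform of the occupation measure *)

Section decreasing_domains.
Local Open Scope ereal_scope.
Context d (T : measurableType d) (R : realType) (mu : {measure set T -> \bar R}).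
(** Dominated convergence for the restrictions of f to the F n. *)
Lemma cvg_integral_nonincreasing_set (F : nat -> set T) (f : T -> R) :
  (forall n, measurable (F n)) -> nonincreasing_seq F ->
  measurable_fun setT f -> (forall x, (0 <= f x)%R) ->
  \int[mu]_(x in F 0%N) (f x)%:E < +oo ->
  \int[mu]_(x in F n) (f x)%:E @[n --> \oo] --> \int[mu]_(x in \bigcap_n F n) (f x)%:E.
Proof.
move=> mF nF mf f0 fin; have mI : measurable (\bigcap_n F n) by exact: bigcap_measurable.
have sF n : F n `<=` F 0%N by apply/subsetPset; exact: nF.
have mfE D : measurable_fun D (fun x => (f x)%:E) by apply/measurable_EFinP; exact: measurable_funTS.
have sub D : D `<=` F 0%N -> \int[mu]_(x in D) (f x)%:E = \int[mu]_(x in F 0%N) ((fun x => (f x)%:E) \_ D) x.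
  by move=> DF; rewrite -integral_mkcondr setIidr.
rewrite (sub (\bigcap_n F n)); last by move=> x; exact.
under eq_fun do rewrite (sub _ (sF _)).
have If : mu.-integrable (F 0%N) (fun x => (f x)%:E).
  apply/integrableP; split; first exact: mfE.
  by under eq_integral do rewrite gee0_abs ?lee_fin//.
apply: (@dominated_cvg _ _ _ _ _ _ _ _ (fun x => (f x)%:E)) => //.
- move=> n; apply/measurable_restrict => //; exact: mfE.
- move=> x F0x; rewrite patchE; case: ifPn => [|/negP xI].
    rewrite inE => xF; apply: cvg_near_cst; apply: nearW => n.
    by rewrite patchE mem_set//; exact: xF.
  have [N nFN] : exists N, ~ F N x.
    by apply/existsNP => h; apply: xI; rewrite inE => n _; exact: h.
  apply: cvg_near_cst; exists N => // n /= Nn.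
  rewrite patchE memNset// => Fn; apply: nFN.
  by have /subsetPset := nF _ _ Nn; exact.
- move=> n x F0x; rewrite patchE; case: ifPn => _; rewrite gee0_abs ?lee_fin//.
Qed.
End decreasing_domains.

Section first_passage.
Context {d : measure_display} {Omega : measurableType d} {R : realType}
        (P : probability Omega R) (J : R -> {RV P >-> R}).
Variable sigma : R.
Hypothesis hJ : subordinator_plus_brownian sigma J.
Let LJ : levy_process J := hJ.1.
Hypothesis J_integrable : P.-integrable setT (EFin \o J 1).
Hypothesis drift_lt0 : mean_drift J < 0.
Implicit Types (x a : R) (n k j N : nat) (w : Omega).
Local Notation phi := (laplace_exponent J).
Local Notation rho := (mean_drift J).
Local Notation T := (Omega * measurableTypeR R)%type.
Local Notation mu := (P \x (@lebesgue_measure R))%E.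

Definition dyadic : set R := \bigcup_n grid (mesh n).

(** A measurable substitute for the set of pairs (w, t) with t < tau_x (w); the two
    are compared in before_hitting_alive and alive_before_hitting. *)
Definition alive_dyadic x : set T := alive_set J dyadic x.

Lemma alive_dyadicE x : alive_dyadic x = \bigcap_n alive_set J (grid (mesh n)) x.
Proof.
apply/seteqP; split => [z [z0 al] n _|z al].
  by split => // q qn; apply: al; exists n.
split; first by have [] := al 0%N Logic.I.
by move=> q [n _ qn]; have [_] := al n Logic.I; exact.
Qed.

Lemma measurable_alive_dyadic x : measurable (alive_dyadic x).
Proof. by rewrite alive_dyadicE; apply: bigcap_measurable => // n _; exact: measurable_alive_set. Qed.

(** W_t is at least the limit of the positive values at dyadic times increasing
    to t. *)
Lemma alive_dyadic_ge0 x z : alive_dyadic x z -> 0 <= x + Jpos J z.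
Proof.
case: z => w t [/= t0 al]; rewrite /Jpos/= max_r//.
pose q n : R := (Num.truncn (2 ^+ n * t))%:R * mesh n.
have p0 n : 0 < 2 ^+ n :> R by rewrite exprn_gt0.
have q0 n : 0 <= q n by rewrite mulr_ge0// ltW// mesh_gt0.
have qt n : q n <= t.
  have /andP[h1 _] := truncn_itv (mulr_ge0 (ltW (p0 n)) t0).
  by rewrite /q /mesh ler_pdivrMr// [leRHS]mulrC.
apply: (@path_lower_limit _ _ _ _ _ _ hJ x w t q) => [n||n].
- by rewrite q0 qt.
- have c : t - mesh n @[n --> \oo] --> t.
    have : t - mesh n @[n --> \oo] --> t - 0.
      by apply: cvgB; [exact: cvg_cst|exact: cvg_mesh].
    by rewrite subr0.
  apply: (@squeeze_cvgr _ _ _ _ (fun n => t - mesh n) (cst t)) => //; last exact: cvg_cst.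
  apply: nearW => n; rewrite qt andbT /q.
  have /andP[_ h2] := truncn_itv (mulr_ge0 (ltW (p0 n)) t0).
  rewrite lerBlDr /mesh -[X in _ + X]mul1r -mulrDl ler_pdivlMr// mulrC natr1; exact: ltW.
- by apply: ltW; apply: al => //; exists n => //; exists (Num.truncn (2 ^+ n * t)).
Qed.

Let occ (Q : set R) a x N : \bar R := (\int[mu]_(z in alive_before J Q x N%:R) (expJ J a x z)%:E)%E.

Let exitW a x N n w := exit_expW J a x (mesh n) (steps N n) w.

Let phi_lt0 a : 0 < a -> phi a < 0.
Proof. exact: (laplace_exponent_lt0 hJ). Qed.

Lemma exit_occupation_mesh a x N n : 0 < a ->
  (\int[P]_w (exitW a x N n w)%:E = (expR (- a * x))%:E + (- phi a)%:E * occ (grid (mesh n)) a x N)%E.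
Proof.
move=> a0; rewrite /exitW (exit_occupation hJ) ?(ltW a0) ?mesh_gt0 ?lt_eqF ?phi_lt0//.
by rewrite steps_mesh.
Qed.

Lemma alive_before_dyadic x N n :
  alive_before J dyadic x N%:R `<=` alive_before J (grid (mesh n)) x N%:R.
Proof.
move=> z [al zN]; split => //; move: al; rewrite -/(alive_dyadic x) alive_dyadicE; exact.
Qed.

Lemma measurable_alive_before_dyadic x (u : R) : measurable (alive_before J dyadic x u).
Proof.
apply: measurableI; first exact: measurable_alive_dyadic.
by rewrite -[X in measurable X]setTI; apply: measurable_snd.
Qed.

Lemma expJ_ge0 a x z : 0 <= expJ J a x z. Proof. exact: expR_ge0. Qed.

(** The dyadic occupation is smaller than the one on any grid; there it is the
    expected exit value minus e^(-a x), and the exit values converge to the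
    exponential of a nonpositive number. Their second moments are exponential
    moments at 2 a, bounded uniformly in the mesh. *)
Lemma occupation_before_upper a x N : 0 < a -> 0 < x ->
  ((- phi a)%:E * occ dyadic a x N <= (1 - expR (- a * x))%:E)%E.
Proof.
move=> a0 x0.
have limX w : exists l : R, l <= 1 /\ exitW a x N n w @[n --> \oo] --> l.
  have [t [t0 Wt] c] := exit_time_cvg hJ N w x0.
  exists (expR (- a * (x + J t w))); split.
    by rewrite -[leRHS]expR0 ler_expR mulNr oppr_le0 mulr_ge0// ltW.
  apply: (@continuous_cvg _ _ _ _ _ _ (fun y => expR (- a * (x + y)))); last exact: c.
  have dE (y : R) : is_derive y 1 (fun y => expR (- a * (x + y))) (- a * expR (- a * (x + y))).
    by apply: is_derive_eq; rewrite /GRing.scale/=; ring.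
  by apply: differentiable_continuous; apply/derivable1_diffP; exact: ex_derive.
have [l hl] := choice limX.
have UI := @limsup_expectation_le1 _ _ _ P (exitW a x N) l (expR (- (2 * a) * x - phi (2 * a) * N%:R)).
apply/lee_addgt0Pr => e e0.
have [||n|w|w|m _ /(_ m (leqnn _)) hm] := UI _ _ _ _ _ e e0.
- by move=> n; exact: measurable_exit_expW.
- by move=> n w; exact: expR_ge0.
- rewrite -(steps_mesh N n).
  have := @expectation_exit_expW_le _ _ _ _ _ _ hJ (2 * a) x (mesh n) (steps N n).
  have a2 : 0 < 2 * a by rewrite mulr_gt0.
  rewrite (ltW a2) (ltW (mesh_gt0 n)) (ltW (phi_lt0 a2)) => /(_ isT isT isT).
  apply: le_trans; rewrite le_eqVlt; apply/orP; left; apply/eqP; apply: eq_integral => w _.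
  by congr EFin; rewrite /exitW /exit_expW /expW -expRM_natl; congr expR; ring.
- by have [] := hl w.
- by have [] := hl w.
have : ((- phi a)%:E * occ dyadic a x N <= (- phi a)%:E * occ (grid (mesh m)) a x N)%E.
  apply: lee_wpmul2l; first by rewrite lee_fin oppr_ge0 ltW// phi_lt0.
  apply: ge0_subset_integral => //.
  - exact: measurable_alive_before_dyadic.
  - exact: measurable_alive_before.
  - by apply/measurable_EFinP; apply: measurable_funTS; exact: (measurable_expJ hJ).
  - by move=> z _; rewrite lee_fin expJ_ge0.
  - exact: alive_before_dyadic.
move=> /le_trans; apply.
rewrite -(@leeD2lE _ (expR (- a * x))%:E)// -exit_occupation_mesh//.
apply: le_trans hm _; rewrite -!EFinD lee_fin; lra.
Qed.

Lemma alive_dyadic_bigcup x : alive_dyadic x = \bigcup_N alive_before J dyadic x N%:R.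
Proof.
apply/seteqP; split => [z al|z [N _ []]//].
exists (Num.truncn z.2).+1 => //; split => //=; have [z0 _] := al.
by rewrite in_itv/= z0 truncnS_gt.
Qed.

Lemma cvg_occupation_before a x : occ dyadic a x N @[N --> \oo] -->
  (\int[mu]_(z in alive_dyadic x) (expJ J a x z)%:E)%E.
Proof.
rewrite alive_dyadic_bigcup; apply: ge0_nondecreasing_set_cvg_integral.
- move=> m n mn; apply/subsetPset => z [al /=]; rewrite in_itv/= => /andP[z0 zm].
  split => //=; rewrite in_itv/= z0; apply: lt_le_trans zm _; by rewrite ler_nat.
- by move=> N; exact: measurable_alive_before_dyadic.
- by move=> N; apply/measurable_EFinP; apply: measurable_funTS; exact: (measurable_expJ hJ).
- by move=> N z _; rewrite lee_fin expJ_ge0.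
Qed.

Lemma occupation_before_le a x N : (occ dyadic a x N <= \int[mu]_(z in alive_dyadic x) (expJ J a x z)%:E)%E.
Proof.
apply: ge0_subset_integral => //.
- exact: measurable_alive_before_dyadic.
- exact: measurable_alive_dyadic.
- by apply/measurable_EFinP; apply: measurable_funTS; exact: (measurable_expJ hJ).
- by move=> z _; rewrite lee_fin expJ_ge0.
- by move=> z [].
Qed.

Lemma occupation_upper a x : 0 < a -> 0 < x ->
  ((- phi a)%:E * \int[mu]_(z in alive_dyadic x) (expJ J a x z)%:E <= (1 - expR (- a * x))%:E)%E.
Proof.
move=> a0 x0; have c : ((- phi a)%:E * occ dyadic a x N @[N --> \oo] -->
    (- phi a)%:E * \int[mu]_(z in alive_dyadic x) (expJ J a x z)%:E)%E.
  by apply: cvgeZl => //; exact: cvg_occupation_before.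
rewrite -(cvg_lim _ c)//; apply: lime_le; first by apply/cvg_ex; eexists; exact: c.
by apply: nearW => N; exact: occupation_before_upper.
Qed.

Lemma expJ_laplace a x : (\int[mu]_(z in alive_dyadic x) (expJ J a x z)%:E =
  laplace_moment mu (alive_dyadic x) (fun z => x + Jpos J z)%R 0 a)%E.
Proof. by apply: eq_integral => z _; rewrite /expJ expr0 mul1r. Qed.

Lemma measurable_height x : measurable_fun setT (fun z : T => x + Jpos J z).
Proof. by apply: measurable_funD => //; exact: (measurable_Jpos LJ). Qed.

Lemma occupation_fin a x : 0 < a -> 0 < x ->
  (\int[mu]_(z in alive_dyadic x) (expJ J a x z)%:E < +oo)%E.
Proof.
move=> a0 x0; have := occupation_upper a0 x0; have p0 := phi_lt0 a0.
rewrite -lee_pdivlMl ?oppr_gt0// => /le_lt_trans; apply.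
by rewrite -EFinM ltry.
Qed.

(** Let a -> 0+ in occupation_upper: 1 - e^(-a x) <= a x, and -phi(a) is at least
    - a rho / (1 - a rho). *)
Lemma measure_alive_dyadic x : 0 < x -> (mu (alive_dyadic x) <= (x / - rho)%:E)%E.
Proof.
move=> x0; pose F a := (\int[mu]_(z in alive_dyadic x) (expJ J a x z)%:E)%E.
have c : F a @[a --> 0^'+] --> mu (alive_dyadic x).
  have := @cvg_laplace_moment _ _ _ mu (alive_dyadic x) (fun z => x + Jpos J z)
    (measurable_alive_dyadic x) (measurable_funTS (measurable_height x)) (@alive_dyadic_ge0 x) 0%N.
  have -> : (\int[mu]_(z in alive_dyadic x) ((x + Jpos J z) ^+ 0)%:E)%E = mu (alive_dyadic x).
    by rewrite -[RHS]mul1e -integral_cst//; exact: measurable_alive_dyadic.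
  by under eq_cvg do rewrite -expJ_laplace.
pose G (a : R) := (x * (1 - a * rho) / - rho)%:E.
have cG : G a @[a --> 0^'+] --> (x / - rho)%:E.
  apply: cvg_EFin; first by apply: nearW.
  have h : x * (1 - a * rho) @[a --> (0:R)] --> x * (1 - 0 * rho).
    by apply: cvgMr; apply: cvgB; [exact: cvg_cst|apply: cvgMl; exact: cvg_id].
  by apply: cvgMl; move: h; rewrite mul0r subr0 mulr1 => /cvg_at_right_filter.
apply: (lee_cvg_to c cG).
near=> a; have a0 : 0 < a by [].
have p0 := phi_lt0 a0; have r1 : a * rho < 0 by rewrite pmulr_rlt0.
have := occupation_upper a0 x0; rewrite -lee_pdivlMl ?oppr_gt0// => /le_trans; apply.
rewrite -EFinM lee_fin ler_pdivrMl ?oppr_gt0//.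
have h1 := laplace_exponent_le hJ J_integrable drift_lt0 a0.
apply: (@le_trans _ _ (a * x)).
  by have := expR_ge1Dx (- a * x); lra.
apply: (@le_trans _ _ (- (a * rho / (1 - a * rho)) * (x * (1 - a * rho) / - rho))).
  rewrite le_eqVlt; apply/orP; left; apply/eqP; field.
  by rewrite (lt_eqF drift_lt0) /= gt_eqF//; lra.
apply: ler_wpM2r; last by rewrite lerN2.
by rewrite divr_ge0 ?oppr_ge0 ?(ltW drift_lt0)// mulr_ge0 ?(ltW x0)//; lra.
Unshelve. all: by end_near. Qed.

(** If the walk has exited, W <= 0 at the exit and the exponential is at least 1.
    Otherwise the walk is alive throughout [0, N[, which contributes N to the
    occupation. In both cases the sum is at least N. *)
Lemma exit_lower a x N n : 0 < a -> 0 < x ->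
  (N%:R%:E <= N%:R%:E * \int[P]_w (exitW a x N n w)%:E +
     mu (alive_before J (grid (mesh n)) x N%:R))%E.
Proof.
move=> a0 x0; set U := alive_before _ _ _ _.
have mU : measurable U by exact: measurable_alive_before.
have mX : measurable_fun setT (exitW a x N n) by exact: measurable_exit_expW.
rewrite -ge0_integralZl//; last 2 first.
- exact/measurable_EFinP.
- by move=> w _; rewrite lee_fin expR_ge0.
have -> : mu U = (\int[P]_w lebesgue_measure (xsection U w))%E by [].
rewrite -ge0_integralD//; last 3 first.
- by move=> w _; rewrite mule_ge0// lee_fin expR_ge0.
- by apply: measurable_funeM; exact/measurable_EFinP.
- exact: measurable_fun_xsection.
have NE : N%:R%:E = (\int[P]_(w in setT) (cst N%:R%:E w : \bar R))%E.
  rewrite integral_cst// [X in (_ * X)%E](_ : _ = 1%E) ?mule1//; exact: probability_setT.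
rewrite [leLHS]NE.
apply: ge0_le_integral => //.
- by move=> w _; rewrite lee_fin.
- apply: emeasurable_funD; last exact: measurable_fun_xsection.
  by apply: measurable_funeM; exact/measurable_EFinP.
move=> w _; have := exit_step_le J (mesh n) x (steps N n) w.
rewrite leq_eqVlt => /predU1P[eK|lt].
  apply: (@le_trans _ _ (lebesgue_measure (xsection U w))); last first.
    by rewrite leeDr// mule_ge0// lee_fin expR_ge0.
  have -> : N%:R%:E = lebesgue_measure (`[0, N%:R[%classic : set R).
    rewrite lebesgue_measure_itv/= lte_fin; case: ltP => [_|]; first by rewrite oppr0 adde0.
    by rewrite (_ : 0 = 0%:R)// ler_nat leqn0 => /eqP ->.
  apply: le_measure; rewrite ?inE//.
    exact: measurable_xsection.
  move=> t /= tN; rewrite /xsection /= inE; split => //=.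
  move: tN; rewrite in_itv/= => /andP[t0 tN].
  split => // _ [j _ <-] /= jt; apply: (@alive_before_exit _ _ _ _ _ x N n).
  by rewrite /exit_time eK steps_mesh; exact: le_lt_trans jt tN.
apply: (@le_trans _ _ (N%:R%:E * (exitW a x N n w)%:E)%E); last by rewrite leeDl.
rewrite -EFinM lee_fin ler_peMr// /exitW /exit_expW /expW -[leLHS]expR0 ler_expR.
by rewrite mulNr oppr_ge0 mulr_ge0_le0 ?(ltW a0)//; exact: exit_stepP.
Qed.

Let alive_before_nonincreasing x N :
  nonincreasing_seq (fun n => alive_before J (grid (mesh n)) x N%:R).
Proof.
apply/nonincreasing_seqP => n; apply/subsetPset => z [[z0 al] zN]; split => //.
split => // _ [j _ <-] jz.
have -> : j%:R * mesh n = (j * 2)%N%:R * mesh n.+1 :> R by rewrite natrM -mulrA -meshS.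
apply: al; first by exists (j * 2)%N.
by rewrite natrM -mulrA -meshS.
Qed.

Let alive_before_dyadicE x N :
  alive_before J dyadic x N%:R = \bigcap_n alive_before J (grid (mesh n)) x N%:R.
Proof.
apply/seteqP; split => [z h n _|z h]; first exact: alive_before_dyadic.
split; last by have [] := h 0%N Logic.I.
by rewrite -/(alive_dyadic x) alive_dyadicE => n _; have [] := h n Logic.I.
Qed.

Lemma occupation_before_grid_fin a x N n : 0 < a -> (occ (grid (mesh n)) a x N < +oo)%E.
Proof.
move=> a0; have p0 := phi_lt0 a0.
have := expectation_exit_expW_le hJ x (steps N n) (ltW a0) (ltW (mesh_gt0 n)) (ltW p0).
have := exit_occupation_mesh x N n a0; rewrite /exitW => ->.
move=> /(le_lt_trans (y := _)) /(_ (ltry _)) h.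
rewrite ltNge; apply/negP; rewrite leye_eq => /eqP e; move: h.
by rewrite e gt0_muley ?lte_fin ?oppr_gt0//.
Qed.

(** Combine exit_lower with exit_occupation and let the mesh tend to 0: the alive
    sets of finer grids decrease to the dyadic one. *)
Lemma occupation_lower a x N : 0 < a -> 0 < x ->
  (N%:R%:E <= N%:R%:E * ((expR (- a * x))%:E + (- phi a)%:E * occ dyadic a x N) +
     mu (alive_before J dyadic x N%:R))%E.
Proof.
move=> a0 x0; have mA n : measurable (alive_before J (grid (mesh n)) x N%:R).
  exact: measurable_alive_before.
have c1 : occ (grid (mesh n)) a x N @[n --> \oo] --> occ dyadic a x N.
  rewrite /occ alive_before_dyadicE; apply: cvg_integral_nonincreasing_set => //.
  - exact: (measurable_expJ hJ).
  - exact: expJ_ge0.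
  - exact: occupation_before_grid_fin.
have c2 : mu (alive_before J (grid (mesh n)) x N%:R) @[n --> \oo] -->
    mu (alive_before J dyadic x N%:R).
  rewrite alive_before_dyadicE; apply: nonincreasing_cvg_mu => //.
    apply: (@le_lt_trans _ _ (mu (setT `*` `[0%R, N%:R[%classic))%E).
      apply: le_measure; rewrite ?inE//; first exact: measurableX.
      by move=> [w t] [_ /=].
    rewrite product_measure1E//= (_ : P _ = 1%E) ?mul1e; last exact: probability_setT.
    by rewrite lebesgue_measure_itv/=; case: ifP; rewrite ?ltry.
  by rewrite -alive_before_dyadicE; exact: measurable_alive_before_dyadic.
have occ0 Q : (0 <= occ Q a x N)%E.
  by apply: integral_ge0 => z _; rewrite lee_fin expJ_ge0.
have p0 : 0 <= - phi a by rewrite oppr_ge0 ltW// phi_lt0.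
have c : (N%:R%:E * ((expR (- a * x))%:E + (- phi a)%:E * occ (grid (mesh n)) a x N) +
     mu (alive_before J (grid (mesh n)) x N%:R))%E @[n --> \oo] -->
   (N%:R%:E * ((expR (- a * x))%:E + (- phi a)%:E * occ dyadic a x N) +
     mu (alive_before J dyadic x N%:R))%E.
  apply: cvgeD => //.
    by apply: ge0_adde_def; rewrite inE// mule_ge0// adde_ge0 ?lee_fin ?expR_ge0// mule_ge0.
  apply: cvgeZl => //; apply: cvgeD; first by rewrite fin_num_adde_defr.
    exact: cvg_cst.
  by apply: cvgeZl.
rewrite -(cvg_lim _ c)//; apply: lime_ge; first by apply/cvg_ex; eexists; exact: c.
by apply: nearW => n; rewrite -exit_occupation_mesh//; exact: exit_lower.
Qed.

(** If the inequality occupation_upper were strict, with gap e, occupation_lower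
    would give N e <= x / -rho for all N. *)
Lemma occupation_identity a x : 0 < a -> 0 < x ->
  ((- phi a)%:E * \int[mu]_(z in alive_dyadic x) (expJ J a x z)%:E =
   (1 - expR (- a * x))%:E)%E.
Proof.
move=> a0 x0; apply/eqP; rewrite eq_le occupation_upper//=.
set I := (\int[mu]_(z in alive_dyadic x) _)%E.
have I0 : (0 <= I)%E by apply: integral_ge0 => z _; rewrite lee_fin expJ_ge0.
have : I \is a fin_num by rewrite ge0_fin_numE// occupation_fin.
move=> /fineK <-; set u := fine I; rewrite -EFinM lee_fin.
rewrite leNgt; apply/negP => lt.
have p0 : 0 <= - phi a by rewrite oppr_ge0 ltW// phi_lt0.
pose e := 1 - expR (- a * x) - - phi a * u.
have e0 : 0 < e by rewrite /e subr_gt0.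
have h (N : nat) : N%:R * e <= x / - rho.
  have : (N%:R%:E <= N%:R%:E * ((expR (- a * x))%:E + (- phi a)%:E * u%:E) + (x / - rho)%:E)%E.
    apply: le_trans (occupation_lower N a0 x0) _; apply: leeD.
      apply: lee_wpmul2l => //; apply: leeD2l; apply: lee_wpmul2l => //.
      by rewrite /u fineK ?occupation_before_le// ge0_fin_numE// occupation_fin.
    apply: le_trans (measure_alive_dyadic x0); apply: le_measure; rewrite ?inE//.
    - exact: measurable_alive_before_dyadic.
    - exact: measurable_alive_dyadic.
    - by move=> z [].
  by rewrite -!EFinM -EFinD lee_fin /e; lra.
have := h (Num.truncn (x / - rho / e)).+1; rewrite leNgt => /negP; apply.
by rewrite -ltr_pdivrMr//; exact: truncnS_gt.
Qed.
End first_passage.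

(** * Derivatives of a quotient *)

Section alternating_derivatives.
Context {R : realType}.
Implicit Types (f u v : R -> R) (a : R).

(** The signed derivative (-1)^k f^(k), which is nonnegative for completely monotone
    f and turns derivation into the map p k |-> - p (k+1). *)
Definition alternating_derivative f (k : nat) a : R := (-1) ^+ k * derive1n k f a.

Lemma is_derive_alternating f k a : derivable (derive1n k f) a 1 ->
  is_derive a 1 (alternating_derivative f k) (- alternating_derivative f k.+1 a).
Proof.
move=> df; have dk : is_derive a 1 (derive1n k f) (derive1n k.+1 f a).
  by rewrite derive1nS derive1E; apply: DeriveDef.
by apply: is_derive_eq; rewrite /alternating_derivative /GRing.scale/= exprS; ring.
Qed.

Lemma is_derive_bigsum n (h : 'I_n -> R -> R) (dh : 'I_n -> R) a :
  (forall i, is_derive a 1 (h i) (dh i)) ->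
  is_derive a 1 (fun b => \sum_(i < n) h i b) (\sum_(i < n) dh i).
Proof. by move=> /is_derive_sum; rewrite fct_sumE. Qed.

Variables (f : R -> R) (F g : nat -> R -> R).
Hypothesis dF : forall k a, 0 < a -> is_derive a 1 (F k) (- F k.+1 a).
Hypothesis dg : forall k a, 0 < a -> is_derive a 1 (g k) (- g k.+1 a).
Hypothesis g_gt0 : forall a, 0 < a -> 0 < g 0%N a.
Hypothesis factor : forall a, 0 < a -> F 0%N a = f a * g 0%N a.
Local Notation p := (alternating_derivative f).

(** Leibniz' rule for the product f g_0. The smoothness of f is part of the
    induction: the identity at level k expresses the k-th derivative of f as a
    quotient of differentiable functions, and can then be differentiated once
    more; Pascal's rule gives level k+1. *)
Lemma alternating_leibniz k :
  (forall i a, (i < k)%N -> 0 < a -> is_derive a 1 (p i) (- p i.+1 a)) /\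
  (forall a, 0 < a -> F k a = \sum_(i < k.+1) 'C(k, i)%:R * p i a * g (k - i)%N a).
Proof.
elim: k => [|k [IHp IHF]].
  split => // a a0; rewrite big_ord_recl big_ord0 /= addr0 factor//.
  by rewrite /alternating_derivative expr0 bin0 subn0 !mul1r.
have near_pos a : 0 < a -> \forall b \near a, 0 < b by move=> a0; exact: lt_nbhsr.
have dpk a : 0 < a -> is_derive a 1 (p k) (- p k.+1 a).
  move=> a0; apply: is_derive_alternating.
  pose G b := (-1) ^+ k * ((F k b - \sum_(i < k) 'C(k, i)%:R * p i b * g (k - i)%N b) / g 0%N b).
  have dG : derivable G a 1.
    have h1 : is_derive a 1 (fun b => \sum_(i < k) 'C(k, i)%:R * p i b * g (k - i)%N b)
        (\sum_(i < k) - ('C(k, i)%:R * (p i.+1 a * g (k - i)%N a + p i a * g (k - i).+1%N a))).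
      apply: is_derive_bigsum => i; have dpi := IHp _ _ (ltn_ord i) a0; have dgi := dg (k - i) a0.
      by apply: is_derive_eq; rewrite /GRing.scale/=; ring.
    apply: derivableZ; apply: derivableM.
      by apply: derivableB; [have [] := dF k a0 | have [] := h1].
    by apply: derivableV; [rewrite gt_eqF// g_gt0 | have [] := dg 0 a0].
  apply: near_eq_derivable dG; near=> b.
  have b0 : 0 < b by near: b; exact: near_pos.
  rewrite /G IHF// big_ord_recr /= binn subnn addrAC subrr add0r mul1r mulfK ?gt_eqF ?g_gt0//.
  by rewrite /alternating_derivative mulrA -expr2 sqrr_sign mul1r.
have dp i a : (i < k.+1)%N -> 0 < a -> is_derive a 1 (p i) (- p i.+1 a).
  by rewrite ltnS leq_eqVlt => /predU1P[->|]; [exact: dpk|exact: IHp].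
split => // a a0.
pose S b := \sum_(i < k.+1) 'C(k, i)%:R * p i b * g (k - i)%N b.
have dS : is_derive a 1 S
    (\sum_(i < k.+1) - ('C(k, i)%:R * (p i.+1 a * g (k - i)%N a + p i a * g (k - i).+1%N a))).
  apply: is_derive_bigsum => i; have dpi := dp _ _ (ltn_ord i) a0; have dgi := dg (k - i) a0.
  by apply: is_derive_eq; rewrite /GRing.scale/=; ring.
have dS' : is_derive a 1 S (- F k.+1 a).
  apply: (near_eq_is_derive (f := F k)); last exact: dF.
  by near=> b; apply: IHF; near: b; exact: near_pos.
have := @derive_val _ _ _ _ _ _ _ dS; have -> := @derive_val _ _ _ _ _ _ _ dS'.
rewrite sumrN => /oppr_inj ->.
transitivity (p 0%N a * g k.+1 a + \sum_(i < k.+1)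
   ('C(k, i.+1)%:R * p i.+1 a * g (k - i)%N a + 'C(k, i)%:R * p i.+1 a * g (k - i)%N a)); last first.
  rewrite [RHS]big_ord_recl /= bin0 subn0 mul1r; congr (_ + _).
  by apply: eq_bigr => i _; rewrite /bump leq0n add1n binS subSS natrD; ring.
rewrite [X in _ = _ + X]big_split /= [X in _ = _ + (X + _)]big_ord_recr /=.
rewrite bin_small// mulr0n !mul0r addr0 addrA.
rewrite (eq_bigr (fun i : 'I_k.+1 => 'C(k, i)%:R * p i.+1 a * g (k - i)%N a +
  'C(k, i)%:R * p i a * g (k - i).+1%N a)); last by move=> i _; ring.
rewrite big_split /= addrC; congr (_ + _).
rewrite big_ord_recl /= bin0 subn0 mul1r; congr (_ + _).
by apply: eq_bigr => i _; rewrite /bump leq0n add1n -subSn// subSS.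
Unshelve. all: by end_near. Qed.
End alternating_derivatives.

(** * Incomplete gamma integrals *)

Section truncated_exponential.
Context {R : realType}.
Implicit Types (x a : R) (k : nat).
Local Notation leb := (@lebesgue_measure R).

(** \int_0^x u^k e^(-a u) du, the lower incomplete gamma function up to a power of a. *)
Definition incomplete_gamma x k a : R :=
  fine (laplace_moment leb `[0, x[%classic (fun u : measurableTypeR R => u) k a).

Let itv_ge0 x (u : measurableTypeR R) : `[0, x[%classic u -> 0 <= u.
Proof. by rewrite /= in_itv/= => /andP[]. Qed.

Let int_expR x a : 0 < x -> 0 < a ->
  (\int[leb]_(u in `[0%R, x[) (expR (- a * u))%:E = ((1 - expR (- a * x)) / a)%:E)%E.
Proof.
move=> x0 a0; under eq_integral do rewrite -[X in _ * X](subr0 _).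
rewrite integral_expR_itv ?gt_eqF// subr0; congr EFin; field.
by rewrite gt_eqF.
Qed.

Let int_expR_fin x a : 0 < x -> 0 < a ->
  (\int[leb]_(u in `[0%R, x[) (expR (- a * u))%:E < +oo)%E.
Proof. by move=> x0 a0; rewrite int_expR// ltry. Qed.

Lemma incomplete_gamma_fin_num x k a : 0 < x -> 0 < a ->
  laplace_moment leb `[0, x[%classic (fun u : measurableTypeR R => u) k a = (incomplete_gamma x k a)%:E.
Proof.
move=> x0 a0; rewrite fineK// laplace_moment_fin_num//; first exact: itv_ge0.
by move=> b b0; exact: int_expR_fin.
Qed.

Lemma incomplete_gamma0 x a : 0 < x -> 0 < a ->
  incomplete_gamma x 0 a = (1 - expR (- a * x)) / a.
Proof.
move=> x0 a0; rewrite /incomplete_gamma /laplace_moment.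
by under eq_integral do rewrite expr0 mul1r; rewrite int_expR.
Qed.

Lemma incomplete_gamma0_gt0 x a : 0 < x -> 0 < a -> 0 < incomplete_gamma x 0 a.
Proof.
move=> x0 a0; rewrite incomplete_gamma0// divr_gt0// subr_gt0 -[ltRHS]expR0 ltr_expR.
by rewrite mulNr oppr_lt0 mulr_gt0.
Qed.

Lemma incomplete_gamma_ge0 x k a : 0 <= incomplete_gamma x k a.
Proof. by rewrite fine_ge0// laplace_moment_ge0//; exact: itv_ge0. Qed.

Lemma incomplete_gamma_le x k a : 0 < x -> 0 < a ->
  incomplete_gamma x k a <= x ^+ k * incomplete_gamma x 0 a.
Proof.
move=> x0 a0; rewrite -lee_fin EFinM -!incomplete_gamma_fin_num//.
have mE j : measurable_fun `[0, x[%classic (fun u : measurableTypeR R => (u ^+ j * expR (- a * u))%:E).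
  exact: measurable_laplace_moment.
rewrite /laplace_moment -ge0_integralZl//; last 3 first.
- exact: mE.
- by move=> u /itv_ge0 u0; rewrite lee_fin mulr_ge0 ?expR_ge0// exprn_ge0.
- by rewrite lee_fin exprn_ge0// ltW.
apply: ge0_le_integral => //.
- by move=> u /itv_ge0 u0; rewrite lee_fin mulr_ge0 ?expR_ge0// exprn_ge0.
- exact: mE.
- by apply: measurable_funeM; exact: mE.
- move=> u; rewrite /= in_itv/= => /andP[u0 ux].
  by rewrite -EFinM lee_fin expr0 mul1r ler_wpM2r ?expR_ge0// lerXn2r ?nnegrE ?(ltW x0)// ltW.
Qed.

Lemma is_derive_incomplete_gamma x k a : 0 < x -> 0 < a ->
  is_derive a 1 (incomplete_gamma x k) (- incomplete_gamma x k.+1 a).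
Proof.
move=> x0 a0; apply: laplace_moment_derive => //; first exact: itv_ge0.
by move=> b b0; exact: int_expR_fin.
Qed.

Lemma cvg_incomplete_gamma x k : 0 < x ->
  incomplete_gamma x k a @[a --> 0^'+] --> x ^+ k.+1 / k.+1%:R.
Proof.
move=> x0; apply: fine_cvg.
suff : laplace_moment leb `[0, x[%classic (fun u : measurableTypeR R => u) k a @[a --> 0^'+] -->
    (x ^+ k.+1 / k.+1%:R)%:E by [].
have <- : (\int[leb]_(u in `[0%R, x[%classic) (u ^+ k)%:E)%E = (x ^+ k.+1 / k.+1%:R)%:E.
  rewrite integral_itv_bndo_bndc; last exact/measurable_EFinP/measurable_funX.
  pose H (u : R) := u ^+ k.+1 / k.+1%:R.
  have dX (u : R) : is_derive u 1 (fun u : R => u ^+ k.+1) (k.+1%:R * u ^+ k).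
    have := @is_deriveX R R id k.+1 u 1 1 (is_derive_id u 1).
    rewrite (_ : id ^+ k.+1 = (fun u : R => u ^+ k.+1)); last by apply/funext => v; rewrite exprfctE.
    by rewrite /GRing.scale/= mulr1.
  have dH (u : R) : is_derive u 1 H (u ^+ k).
    rewrite /H; apply: is_derive_eq; rewrite /GRing.scale/=; field.
    by apply: lt0r_neq0; have := ler0n R k; lra.
  have cH (u : R) : {for u, continuous H}.
    by apply: differentiable_continuous; apply/derivable1_diffP; exact: ex_derive.
  rewrite (@continuous_FTC2 _ _ H _ _ x0).
  - by rewrite /H expr0n/= mul0r sube0.
  - by apply: continuous_subspaceT => u; exact: exprn_continuous.
  - split => [u _| |]; first exact: ex_derive.
    + exact: cvg_at_right_filter (cH 0).
    + exact: cvg_at_left_filter (cH x).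
  - by move=> u _; rewrite derive1E; exact: derive_val.
by apply: (cvg_laplace_moment (f := fun u : measurableTypeR R => u)) => //; exact: itv_ge0.
Qed.
End truncated_exponential.

(** * Complete monotonicity of psi and moments of the occupation measure *)

Section occupation_moments.
Context {d : measure_display} {Omega : measurableType d} {R : realType}
        (P : probability Omega R) (J : R -> {RV P >-> R}).
Variable sigma : R.
Hypothesis hJ : subordinator_plus_brownian sigma J.
Hypothesis J_integrable : P.-integrable setT (EFin \o J 1).
Hypothesis drift_lt0 : mean_drift J < 0.
Implicit Types (x a : R) (i k : nat).
Local Notation phi := (laplace_exponent J).
Local Notation rho := (mean_drift J).
Local Notation T := (Omega * measurableTypeR R)%type.
Local Notation mu := (P \x (@lebesgue_measure R))%E.
Local Notation height x := (fun z : T => x + Jpos J z)%R.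
Local Notation moment x := (laplace_moment mu (alive_dyadic J x) (height x)).
Local Notation p := (alternating_derivative (psi J)).

Let mD x : measurable (alive_dyadic J x). Proof. exact: measurable_alive_dyadic. Qed.

Let mH x : measurable_fun (alive_dyadic J x) (height x).
Proof. by apply: measurable_funTS; exact: (measurable_height hJ). Qed.

Let H0 x z : alive_dyadic J x z -> 0 <= x + Jpos J z.
Proof. exact: (alive_dyadic_ge0 hJ). Qed.

Let fin x a : 0 < x -> 0 < a ->
  (\int[mu]_(z in alive_dyadic J x) (expR (- a * (x + Jpos J z)))%:E < +oo)%E.
Proof. by move=> x0 a0; have := occupation_fin hJ J_integrable drift_lt0 a0 x0. Qed.

Let moment_fin x k a : 0 < x -> 0 < a -> moment x k a \is a fin_num.
Proof.
move=> x0; exact: (laplace_moment_fin_num (@mD x) (@mH x) (@H0 x) (fun b b0 => fin x0 b0)).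
Qed.

Let F x k a := - rho * fine (moment x k a).

Let dF x k a : 0 < x -> 0 < a -> is_derive a 1 (F x k) (- F x k.+1 a).
Proof.
move=> x0 a0.
have h := @laplace_moment_derive _ _ _ _ _ _ (@mD x) (@mH x) (@H0 x) (fun b b0 => fin x0 b0) k a a0.
by apply: is_derive_eq; rewrite /GRing.scale/= /F; ring.
Qed.

(** occupation_identity in the form required by alternating_leibniz, namely
    -rho \int e^(-a y) mu_x(dy) = psi(a) \int_0^x e^(-a u) du. *)
Let psi_factor x a : 0 < x -> 0 < a -> F x 0 a = psi J a * incomplete_gamma x 0 a.
Proof.
move=> x0 a0; have := occupation_identity hJ J_integrable drift_lt0 a0 x0.
rewrite (expJ_laplace J) -[moment x 0 a]fineK ?moment_fin//.
rewrite -EFinM => -[e]; rewrite /F /psi (laplace_exponent_slope0E hJ)// incomplete_gamma0// -e.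
have p0 := laplace_exponent_lt0 hJ J_integrable drift_lt0 a0.
by field; rewrite gt_eqF//= lt_eqF.
Qed.

Let leibniz x k : 0 < x ->
  (forall i a, (i < k)%N -> 0 < a -> is_derive a 1 (p i) (- p i.+1 a)) /\
  (forall a, 0 < a -> F x k a = \sum_(i < k.+1) 'C(k, i)%:R * p i a * incomplete_gamma x (k - i)%N a).
Proof.
move=> x0.
exact: (@alternating_leibniz _ (psi J) (F x) (incomplete_gamma x) (fun k a => @dF x k a x0)
  (fun k a => @is_derive_incomplete_gamma _ x k a x0) (fun a => @incomplete_gamma0_gt0 _ x a x0)
  (fun a => @psi_factor x a x0)).
Qed.

(** Divide the identity at level k by g_0 (x) > 0. The left side is nonnegative, and
    the terms with i < k are O(x) since g_j (x) <= x^j g_0 (x); the remaining term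
    p k a does not depend on x, so x -> 0 gives the sign. *)
Lemma alternating_psi_ge0 k a : 0 < a -> 0 <= p k a.
Proof.
move=> a0; pose C := \sum_(i < k) 'C(k, i)%:R * `|p i a|.
have C0 : 0 <= C by apply: sumr_ge0 => i _; rewrite mulr_ge0.
have h x : 0 < x <= 1 -> - (C * x) <= p k a.
  move=> /andP[x0 x1]; have [_ /(_ a a0)] := leibniz k x0.
  rewrite big_ord_recr /= binn mul1r subnn => FE.
  have g0 := incomplete_gamma0_gt0 x0 a0.
  rewrite -(ler_pM2r g0) -[leRHS](addrK (\sum_(i < k) 'C(k, i)%:R * p i a * incomplete_gamma x (k - i)%N a)).
  rewrite [X in _ <= X - _]addrC -FE lerBrDr.
  apply: (@le_trans _ _ 0); last first.
    rewrite /F mulr_ge0 ?oppr_ge0 ?(ltW drift_lt0)// fine_ge0// laplace_moment_ge0//; exact: H0.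
  rewrite addrC mulNr subr_le0 /C !mulr_suml; apply: ler_sum => i _.
  move: (p i a) => q; rewrite -!mulrA ler_wpM2l//.
  apply: le_trans (ler_norm _) _; rewrite normrM ler_wpM2l// ger0_norm ?incomplete_gamma_ge0//.
  apply: le_trans (incomplete_gamma_le _ x0 a0) _; rewrite ler_wpM2r ?(ltW g0)//.
  rewrite -[leRHS]expr1 ler_wiXn2l ?(ltW x0)// subn_gt0//.
rewrite leNgt; apply/negP => pk0.
have C1 : 0 < C + 1 by lra.
(* with this x the bound p k a >= - C x contradicts p k a < 0 *)
pose x := Num.min 1 (- p k a / (C + 1)).
have x0 : 0 < x by rewrite /x lt_min ltr01 divr_gt0// oppr_gt0.
have := h x; rewrite x0 ge_min lexx => /(_ isT).
have : x <= - p k a / (C + 1) by rewrite ge_min lexx orbT.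
rewrite ler_pdivlMr// mulrDr mulr1; lra.
Qed.

Lemma alternating_psi_nonincreasing k a b : 0 < a -> a <= b -> p k b <= p k a.
Proof.
move=> a0 ab; have [dp _] := leibniz k.+1 (@ltr01 R).
have {}dp (u : R) : 0 < u -> is_derive u 1 (p k) (- p k.+1 u) by move=> u0; exact: dp.
have pos (u : R) : u \in `]a, b[ -> 0 < u by rewrite in_itv/= => /andP[/(lt_trans a0)].
apply: (ler0_derive1_nincr (a := a) (b := b)) => // [u /pos u0|u /pos u0|].
- by have [] := dp u u0.
- rewrite derive1E; have -> := @derive_val _ _ _ _ _ _ _ (dp u u0).
  by rewrite oppr_le0 alternating_psi_ge0.
- apply: derivable_within_continuous => u; rewrite in_itv/= => /andP[/(lt_le_trans a0) u0 _].
  by have [] := dp u u0.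
Qed.

(** A nonincreasing function has a limit at 0+ in the extended reals, hence the limit
    defining psi_coef exists. *)
Lemma cvg_alternating_psi k :
  (p k a)%:E @[a --> 0^'+] --> (((-1) ^+ k)%:E * psi_coef J k)%E.
Proof.
have c := @nonincreasing_at_right_cvge _ (fun a => (p k a)%:E) 0 (BLeft 1) _ _.
have {}c : cvg ((p k a)%:E @[a --> 0^'+]).
  apply/cvg_ex; eexists; apply: c; first by rewrite bnd_simp.
  move=> u v; rewrite !in_itv/= => /andP[u0 _] _ uv; rewrite lee_fin.
  exact: alternating_psi_nonincreasing.
set l := lim ((p k a)%:E @[a --> 0^'+]) in c.
have c' : (derive1n k (psi J) a)%:E @[a --> 0^'+] --> (((-1) ^+ k)%:E * l)%E.
  have -> : (fun a => (derive1n k (psi J) a)%:E) = (fun a => ((-1) ^+ k)%:E * (p k a)%:E)%E.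
    by apply/funext => a; rewrite -EFinM /alternating_derivative mulrA -expr2 sqrr_sign mul1r.
  by apply: cvgeZl.
rewrite /psi_coef (cvg_lim _ c')// muleA -EFinM -expr2 sqrr_sign mul1e; exact: c.
Qed.

Lemma psi_coef_ge0 k : (0 <= ((-1) ^+ k)%:E * psi_coef J k)%E.
Proof.
have c := @cvg_alternating_psi k.
rewrite -(cvg_lim _ c)//; apply: lime_ge; first by apply/cvg_ex; eexists; exact: c.
near=> a; rewrite lee_fin alternating_psi_ge0//; near: a; exact: nbhs_right_gt.
Unshelve. all: by end_near. Qed.

(** Let a -> 0+ in Leibniz' formula. All terms are nonnegative and the incomplete
    gamma integrals have positive finite limits, so that an infinite psi_coef
    creates no indeterminate form. *)
Lemma occupation_moment x k : 0 < x ->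
  ((- rho)%:E * \int[mu]_(z in alive_dyadic J x) ((x + Jpos J z) ^+ k)%:E =
   \sum_(i < k.+1) ('C(k, i)%:R)%:E * (((-1) ^+ i)%:E * psi_coef J i) *
      (x ^+ (k - i).+1 / (k - i).+1%:R)%:E)%E.
Proof.
move=> x0.
have c1 : ((- rho)%:E * moment x k a @[a --> 0^'+] -->
    (- rho)%:E * \int[mu]_(z in alive_dyadic J x) ((x + Jpos J z) ^+ k)%:E)%E.
  by apply: cvgeZl => //; exact: (cvg_laplace_moment (@mD x) (@mH x) (@H0 x)).
have c2 : (\sum_(i < k.+1) ('C(k, i)%:R)%:E * (p i a)%:E * (incomplete_gamma x (k - i) a)%:E @[a --> 0^'+] -->
   \sum_(i < k.+1) ('C(k, i)%:R)%:E * (((-1) ^+ i)%:E * psi_coef J i) *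
      (x ^+ (k - i).+1 / (k - i).+1%:R)%:E)%E.
  apply: cvg_nnesum => i _.
    near=> a; rewrite -!EFinM lee_fin mulr_ge0 ?incomplete_gamma_ge0// mulr_ge0//.
    by rewrite alternating_psi_ge0//; near: a; exact: nbhs_right_gt.
  have g0 : x ^+ (k - i).+1 / (k - i).+1%:R != 0 :> R.
    by rewrite gt_eqF// divr_gt0// exprn_gt0.
  apply: cvgeM.
  - by case: (_%:E * _)%E.
  - by apply: cvgeZl => //; exact: cvg_alternating_psi.
  - by apply/cvg_EFin; [exact: nearW|exact: cvg_incomplete_gamma].
suff c3 : ((- rho)%:E * moment x k a @[a --> 0^'+] -->
   \sum_(i < k.+1) ('C(k, i)%:R)%:E * (((-1) ^+ i)%:E * psi_coef J i) *
      (x ^+ (k - i).+1 / (k - i).+1%:R)%:E)%E by exact: (cvg_unique _ c1 c3).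
apply: cvg_trans c2; apply: near_eq_cvg; near=> a.
have a0 : 0 < a by near: a; exact: nbhs_right_gt.
rewrite -[moment x k a]fineK ?moment_fin//.
rewrite -EFinM; have [_ /(_ a a0)] := leibniz k x0; rewrite /F => ->; rewrite -sumEFin.
by apply: eq_bigr => i _; rewrite !EFinM.
Unshelve. all: by end_near. Qed.
End occupation_moments.

(** * Nested sums *)

Section nested_sum_theory.
Context {R : realType}.
Local Open Scope ereal_scope.
Variable p : nat -> \bar R.
Hypothesis p_ge0 : forall i, 0 <= ((-1) ^+ i)%:E * p i.
Implicit Types (x y l : R) (ks : seq nat) (e k N : nat).

Let coef n i : \bar R :=
  ('C(n, i)%:R)%:E * (((-1) ^+ i)%:E * p i) * ((n - i + 1)%:R^-1)%:E.

Let coef_ge0 n i : 0 <= coef n i.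
Proof. by rewrite /coef mule_ge0 ?lee_fin ?invr_ge0// mule_ge0 ?p_ge0 ?lee_fin. Qed.

Lemma nested_sum_cons x k ks e : nested_sum p x (k :: ks) e =
  \sum_(0 <= i < (k + e).+1) coef (k + e) i * nested_sum p x ks (e + (k + 1) - i).
Proof. by []. Qed.

Lemma nested_sum_ge0 x ks e : (0 <= x)%R -> 0 <= nested_sum p x ks e.
Proof.
move=> x0; elim: ks e => [|k ks IH] e; first by rewrite lee_fin exprn_ge0.
by rewrite nested_sum_cons; apply: sume_ge0 => i _; rewrite mule_ge0 ?coef_ge0.
Qed.

Lemma nested_sum_le x y ks e : (0 <= x)%R -> (x <= y)%R ->
  nested_sum p x ks e <= nested_sum p y ks e.
Proof.
move=> x0 xy; have y0 := le_trans x0 xy.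
elim: ks e => [|k ks IH] e; first by rewrite lee_fin lerXn2r.
by rewrite !nested_sum_cons; apply: lee_sum => i _; apply: lee_wpmul2l; rewrite ?coef_ge0.
Qed.

(** All exponents of x in the nested sum are at most e + sum of the k_j + 1, and the
    coefficients are nonnegative. *)
Lemma nested_sum_scale l x ks e N : (0 <= l <= 1)%R -> (0 <= x)%R ->
  (e + \sum_(k <- ks) k.+1 <= N)%N ->
  (l ^+ N)%:E * nested_sum p x ks e <= nested_sum p (l * x) ks e.
Proof.
move=> /andP[l0 l1] x0; elim: ks e => [|k ks IH] e.
  rewrite big_nil addn0 => eN; rewrite /= -EFinM lee_fin exprMn ler_wpM2r ?exprn_ge0//.
  exact: ler_wiXn2l.
rewrite big_cons => eN; rewrite !nested_sum_cons ge0_sume_distrr; last first.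
  by move=> i _; rewrite mule_ge0 ?coef_ge0 ?nested_sum_ge0.
apply: lee_sum => i _; rewrite muleCA; apply: lee_wpmul2l; rewrite ?coef_ge0//; apply: IH.
by apply: leq_trans eN; rewrite addn1 [leqRHS]addnA leq_add2r leq_subr.
Qed.

Lemma measurable_nested_sum ks e : measurable_fun setT (fun x : R => nested_sum p x ks e).
Proof.
elim: ks e => [|k ks IH] e; first by apply/measurable_EFinP; exact: measurable_funX.
under eq_fun do rewrite nested_sum_cons.
by apply: emeasurable_sum => i; exact: measurable_funeM.
Qed.

(** Integration against a measure with the moments of mu_x appends a level: the
    summation over the existing levels is moved out of the integral, and the
    monomial that remains is integrated by hypothesis. *)
Lemma integral_nested_sum d (T : measurableType d) (mu : {measure set T -> \bar R})
    (D : set T) (h : T -> R) (c : \bar R) x :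
  measurable D -> measurable_fun D h -> (forall z, D z -> (0 <= h z)%R) ->
  0 <= c -> (0 <= x)%R ->
  (forall k, \int[mu]_(z in D) (h z ^+ k)%:E = c * nested_sum p x [:: k] 0) ->
  forall k ks e, \int[mu]_(z in D) ((h z ^+ k)%:E * nested_sum p (h z) ks e) =
    c * nested_sum p x (rcons ks k) e.
Proof.
move=> mD mh h0 c0 x0 moment k; elim => [|j ks IH] e.
  under eq_integral do rewrite -EFinM -exprD.
  rewrite moment /= add0n addn0; congr (c * _); apply: eq_big_nat => i /andP[_ ik].
  by rewrite !addn1 addnS (addnC e).
have mN j' e' : measurable_fun D (fun z => (h z ^+ k)%:E * nested_sum p (h z) j' e').
  apply: emeasurable_funM; first by apply/measurable_EFinP; exact: measurable_funX.
  exact: measurableT_comp (measurable_nested_sum _ _) mh.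
have N0 j' e' z : D z -> 0 <= (h z ^+ k)%:E * nested_sum p (h z) j' e'.
  by move=> Dz; rewrite mule_ge0 ?nested_sum_ge0 ?h0// lee_fin exprn_ge0 ?h0.
rewrite rcons_cons nested_sum_cons.
transitivity (\int[mu]_(z in D) \sum_(0 <= i < (j + e).+1)
   coef (j + e) i * ((h z ^+ k)%:E * nested_sum p (h z) ks (e + (j + 1) - i))).
  apply: eq_integral => z; rewrite inE => Dz; rewrite nested_sum_cons ge0_sume_distrr.
    by apply: eq_bigr => i _; rewrite muleCA.
  by move=> i _; rewrite mule_ge0 ?coef_ge0 ?nested_sum_ge0 ?h0.
rewrite ge0_integral_sum//; last 2 first.
- by move=> i; exact: measurable_funeM.
- by move=> i z Dz; rewrite mule_ge0 ?coef_ge0 ?N0.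
rewrite ge0_sume_distrr; last by move=> i _; rewrite mule_ge0 ?coef_ge0 ?nested_sum_ge0.
apply: eq_bigr => i _; rewrite ge0_integralZl ?coef_ge0//; last by move=> z; exact: N0.
by rewrite IH muleCA.
Qed.
End nested_sum_theory.

(** * From the occupation integral to Gamma_a *)

Section hitting.
Context {d : measure_display} {Omega : measurableType d} {R : realType}
        (P : probability Omega R) (J : R -> {RV P >-> R}).
Variable sigma : R.
Hypothesis hJ : subordinator_plus_brownian sigma J.
Let LJ : levy_process J := hJ.1.
Implicit Types (x y s t l : R) (w : Omega) (f g : R -> \bar R).
Local Notation T := (Omega * measurableTypeR R)%type.
Local Notation mu := (P \x (@lebesgue_measure R))%E.

Definition before_hitting x w : set R := [set t : R | 0 <= t /\ (t%:E < hitting_time J x w)%E].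

(** The infimum m of the times with W <= 0 has W_m <= 0 by right-continuity and
    W_m >= 0 because all jumps are upward. So W_m = 0 and the hitting time is at
    most m. *)
Lemma positive_before_hitting x w s t : 0 < x -> before_hitting x w t ->
  0 <= s <= t -> 0 < x + J s w.
Proof.
move=> x0 [t0 tT] /andP[s0 st]; rewrite ltNge; apply/negP => xs.
pose E := [set u : R | 0 <= u /\ x + J u w <= 0].
have lbE : has_lbound E by exists 0 => u [].
have Es : E s by [].
have infE : has_inf E by split => //; exists s.
set m := inf E.
have m0 : 0 <= m by apply: lb_le_inf; [exists s|move=> u []].
have ms : m <= s by exact: ge_inf.
have pos u : 0 <= u -> u < m -> 0 < x + J u w.
  move=> u0 um; rewrite ltNge; apply/negP => xu.
  by move: um; rewrite ltNge ge_inf.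
have le0 : x + J m w <= 0.
  rewrite leNgt; apply/negP => xm.
  have /cvgrPdist_lt /(_ _ xm) := @levy_right_continuous _ _ _ _ _ LJ w m m0.
  rewrite near_withinE near_simpl => /nbhs_ballP[r /= r0 hr].
  have [u [u0 xu] ur] := inf_adherent r0 infE.
  have mu_ : m <= u by exact: ge_inf.
  have [mu'|mu'] := eqVneq m u; first by move: xu; rewrite -mu' leNgt xm.
  have : `|J m w - J u w| < x + J m w.
    apply: hr; last by rewrite lt_neqAle mu' mu_.
    by rewrite /ball/= distrC ger0_norm ?subr_ge0// ltrBlDl.
  by move=> /(le_lt_trans (ler_norm _)); lra.
have ge0 : 0 <= x + J m w.
  have [->|mn0] := eqVneq m 0; first by rewrite (levy0 LJ) addr0 ltW.
  have mpos : 0 < m by rewrite lt_neqAle eq_sym mn0.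
  have hm n : m * mesh n <= m by rewrite ler_piMr// invf_le1 ?exprn_gt0// exprn_ege1// ler1n.
  apply: (path_lower_limit hJ (q := fun n => m - m * mesh n)) => [n||n].
  - by rewrite subr_ge0 hm lerBlDr lerDl mulr_ge0// ltW// mesh_gt0.
  - have : m - m * mesh n @[n --> \oo] --> m - m * 0.
      by apply: cvgB; [exact: cvg_cst|apply: cvgMr; exact: cvg_mesh].
    by rewrite mulr0 subr0.
  - by apply: ltW; apply: pos; rewrite ?subr_ge0// ltrBlDr ltrDl mulr_gt0// mesh_gt0.
have Tm : (hitting_time J x w <= m%:E)%E.
  by apply: ereal_inf_lbound; exists m => //; split => //; apply/eqP; rewrite eq_le le0.
by have := lt_le_trans tT Tm; rewrite lte_fin ltNge (le_trans ms st).
Qed.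

Lemma before_hitting_alive x w t : 0 < x -> before_hitting x w t -> alive_dyadic J x (w, t).
Proof.
move=> x0 tT; split; first by case: tT.
move=> q [n _ [j _ jq]] /= qt; apply: (positive_before_hitting x0 tT).
by rewrite qt andbT -jq mulr_ge0// ltW// mesh_gt0.
Qed.

(** From y < x the path started at x stays above x - y > 0 up to t, and slightly
    longer by right-continuity, so it hits 0 strictly after t. *)
Lemma alive_before_hitting x y w t : y < x -> alive_dyadic J y (w, t) -> before_hitting x w t.
Proof.
move=> yx al; have [/= t0 alq] := al; split => //.
have ge s : 0 <= s -> s <= t -> 0 <= y + J s w.
  move=> s0 st; have : alive_dyadic J y (w, s).
    by split => //= q Qq qs; apply: alq => //; exact: le_trans st.
  by move=> /(alive_dyadic_ge0 hJ); rewrite /Jpos /= max_r.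
have xy0 : 0 < x - y by rewrite subr_gt0.
have /cvgrPdist_lt /(_ _ xy0) := @levy_right_continuous _ _ _ _ _ LJ w t t0.
rewrite near_withinE near_simpl => /nbhs_ballP[r /= r0 hr].
apply: (@lt_le_trans _ _ (t + r)%:E); first by rewrite lte_fin ltrDl.
apply: le_ereal_inf_tmp => _ [u [u0 xu] <-]; rewrite lee_fin leNgt; apply/negP => utr.
have [ut|tu] := leP u t; first by have := ge u u0 ut; lra.
have : `|J t w - J u w| < x - y.
  by apply: hr => //; rewrite /ball/= distrC ger0_norm ?subr_ge0 ?ltW// ltrBlDl.
by move=> /(le_lt_trans (ler_norm _)); have := ge t t0 (lexx _); lra.
Qed.

Definition occupation_integral g x : \bar R :=
  (\int[mu]_(z in alive_dyadic J x) g (x + Jpos J z)%R)%E.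

Section sandwich.
Variables (f g : R -> \bar R).
(** W is positive before the hitting time, so the values of f elsewhere do not
    matter; g is a representative of f on the positive half-line with good global
    properties. *)
Hypothesis fg : forall y, 0 < y -> f y = g y.
Hypothesis mg : measurable_fun setT g.
Hypothesis g0 : forall y, 0 <= y -> (0 <= g y)%E.

Let fubini_restrict (D : set T) (k : T -> R) : measurable D -> measurable_fun setT k ->
  (forall z, D z -> 0 <= k z) ->
  (\int[mu]_(z in D) g (k z) =
   \int[P]_w \int[lebesgue_measure]_t ((fun z => g (k z)) \_ D) (w, t))%E.
Proof.
move=> mD mk k0; rewrite integral_mkcond fubini_tonelli1//.
- by apply/(measurable_restrictT _ _).1 => //; apply: measurable_funTS; exact: measurableT_comp.
- by move=> z; rewrite patchE; case: ifPn => // /[!inE] /k0 /g0.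
Qed.

Lemma Gamma_a_le x : 0 < x -> (Gamma_a J f x <= occupation_integral g x)%E.
Proof.
move=> x0; rewrite /occupation_integral fubini_restrict; last 3 first.
- exact: measurable_alive_dyadic.
- exact: (measurable_height hJ).
- by move=> z; exact: (alive_dyadic_ge0 hJ).
rewrite /Gamma_a; apply: le_integral_nonmeasurable => w.
  apply: integral_ge0 => t tT; have xt := positive_before_hitting x0 tT (s := t).
  by have [t0 _] := tT; rewrite fg ?g0 ?ltW ?xt ?t0 ?lexx.
rewrite /path_area integral_mkcond; apply: le_integral_nonmeasurable => t.
  rewrite patchE; case: ifPn => // /[!inE] tT; have [t0 _] := tT.
  by have xt := positive_before_hitting x0 tT (s := t); rewrite fg ?g0 ?ltW ?xt ?t0 ?lexx.
rewrite !patchE; case: ifPn => [/[!inE] tT|_].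
  rewrite mem_set; last exact: before_hitting_alive.
  have [t0 _] := tT; rewrite /Jpos/= max_r//.
  by have xt := positive_before_hitting x0 tT (s := t); rewrite fg ?xt ?t0 ?lexx.
by case: ifPn => // /[!inE] al; rewrite g0// (alive_dyadic_ge0 hJ).
Qed.

Hypothesis g_le : forall y z, 0 <= y -> y <= z -> (g y <= g z)%E.

Lemma Gamma_a_ge x y : 0 < y -> y < x -> (occupation_integral g y <= Gamma_a J f x)%E.
Proof.
move=> y0 yx; have x0 := lt_trans y0 yx.
rewrite /occupation_integral fubini_restrict; last 3 first.
- exact: measurable_alive_dyadic.
- exact: (measurable_height hJ).
- by move=> z; exact: (alive_dyadic_ge0 hJ).
have pos w t : (0 <= ((fun z => g (y + Jpos J z)%R) \_ (alive_dyadic J y)) (w, t))%E.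
  by rewrite patchE; case: ifPn => // /[!inE] al; rewrite g0// (alive_dyadic_ge0 hJ).
rewrite /Gamma_a; apply: le_integral_nonmeasurable => w; first exact: integral_ge0.
rewrite /path_area [leRHS]integral_mkcond; apply: le_integral_nonmeasurable => t //.
rewrite !patchE; case: ifPn => [/[!inE] al|_].
  have tT := alive_before_hitting yx al.
  rewrite mem_set//; have [t0 _] := tT; rewrite /Jpos/= max_r//.
  rewrite fg; last by apply: (positive_before_hitting x0 tT); rewrite t0 lexx.
  apply: g_le; last by rewrite lerD2r ltW.
  by have := alive_dyadic_ge0 hJ al; rewrite /Jpos/= max_r.
case: ifPn => // /[!inE] tT; have [t0 _] := tT.
by have xt := positive_before_hitting x0 tT (s := t); rewrite fg ?g0 ?ltW ?xt ?t0 ?lexx.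
Qed.

(** The occupation integral is left lower semicontinuous at x by the scaling bound, so
    the bounds Gamma_a_ge at l x, as l -> 1-, meet the bound Gamma_a_le at x. *)
Lemma Gamma_a_occupation x N : 0 < x ->
  (forall l, 0 < l < 1 ->
    ((l ^+ N)%:E * occupation_integral g x <= occupation_integral g (l * x))%E) ->
  Gamma_a J f x = occupation_integral g x.
Proof.
move=> x0 scale; apply/eqP; rewrite eq_le Gamma_a_le//=.
set I := occupation_integral g x.
have c : ((l ^+ N)%:E * I @[l --> 1^'-] --> I)%E.
  rewrite -[X in _ --> X]mul1e; apply: cvgeM; last exact: cvg_cst.
    by case: I => [r||]; rewrite /mule_def ?oner_eq0.
  apply/cvg_EFin; first exact: nearW.
  have h : l ^+ N @[l --> (1 : R)] --> (1 : R) ^+ N by exact: exprn_continuous.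
  by move: h; rewrite expr1n => /cvg_at_left_filter.
rewrite -(cvg_lim _ c)//; apply: lime_le; first by apply/cvg_ex; eexists; exact: c.
near=> l; have l1 : l < 1 by [].
have l0 : 0 < l by near: l; apply: nbhs_left_gt.
apply: le_trans (scale l _) _; first by rewrite l0.
by apply: Gamma_a_ge; rewrite ?mulr_gt0// gtr_pMl.
Unshelve. all: by end_near. Qed.
End sandwich.

End hitting.

(** * Strings of power functions *)

Section strings.
Context {d : measure_display} {Omega : measurableType d} {R : realType}
        (P : probability Omega R) (J : R -> {RV P >-> R}).
Variable sigma : R.
Hypothesis hJ : subordinator_plus_brownian sigma J.
Hypothesis J_integrable : P.-integrable setT (EFin \o J 1).
Hypothesis drift_lt0 : mean_drift J < 0.
Local Notation rho := (mean_drift J).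
Local Notation T := (Omega * measurableTypeR R)%type.
Local Notation mu := (P \x (@lebesgue_measure R))%E.

Let p_ge0 : forall i, (0 <= ((-1) ^+ i)%:E * psi_coef J i)%E.
Proof. exact: psi_coef_ge0 hJ J_integrable drift_lt0. Qed.

Let c0 : 0 <= (- rho)^-1.
Proof. by rewrite invr_ge0 oppr_ge0 ltW. Qed.

(** occupation_moment, with its sum read as a nested sum of depth one. *)
Lemma occupation_power x k : 0 < x ->
  (\int[mu]_(z in alive_dyadic J x) ((x + Jpos J z) ^+ k)%:E =
   ((- rho)^-1)%:E * nested_sum (psi_coef J) x [:: k] 0)%E.
Proof.
move=> x0; have r0 : - rho != 0 by rewrite oppr_eq0 lt_eqF.
have := occupation_moment hJ J_integrable drift_lt0 k x0.
move=> /(congr1 (fun y => ((- rho)^-1)%:E * y)%E).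
rewrite muleA -EFinM mulVf// mul1e => ->; congr (_ * _)%E.
rewrite /= addn0 big_mkord; apply: eq_bigr => i _.
rewrite -[RHS]muleA -EFinM; congr (_ * _%:E)%E.
by rewrite add0n !addn1 subSn 1?mulrC// -ltnS.
Qed.

Lemma occupation_nested k ks e x : 0 < x ->
  occupation_integral J (fun y => power_fun k y * nested_sum (psi_coef J) y ks e)%E x =
  (((- rho)^-1)%:E * nested_sum (psi_coef J) x (rcons ks k) e)%E.
Proof.
move=> x0; apply: (integral_nested_sum p_ge0) => //.
- exact: measurable_alive_dyadic.
- by apply: measurable_funTS; exact: (measurable_height hJ).
- by move=> z; exact: (alive_dyadic_ge0 hJ).
- exact: ltW.
- by move=> j; exact: occupation_power.
Qed.

(** Induction from the innermost factor: the operators are applied in the order of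
    ks, and each one integrates the power y^k times the nested sum already obtained. *)
Lemma Gamma_a_string_nested_sum ks x : 0 < x ->
  Gamma_a_string J (rev [seq power_fun i | i <- ks]) x =
    (((- rho) ^- size ks)%:E * nested_sum (psi_coef J) x ks 0)%E.
Proof.
elim/last_ind: ks x => [|ks k IH] x x0; first by rewrite /= expr0 invr1 mul1e expr0.
rewrite map_rcons rev_rcons /=.
pose c := (((- rho) ^- size ks)%:E : \bar R).
have cge0 : (0 <= c)%E by rewrite lee_fin invr_ge0 exprn_ge0// oppr_ge0 ltW.
pose h y := (power_fun k y * nested_sum (psi_coef J) y ks 0)%E.
have h0 y : 0 <= y -> (0 <= h y)%E.
  by move=> y0; rewrite /h mule_ge0 ?nested_sum_ge0// lee_fin exprn_ge0.
have mh : measurable_fun setT h.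
  apply: emeasurable_funM; last exact: measurable_nested_sum.
  by apply/measurable_EFinP; exact: measurable_funX.
pose g y := (c * h y)%E.
have occE y : 0 < y -> occupation_integral J g y =
    (((- rho) ^- (size ks).+1)%:E * nested_sum (psi_coef J) y (rcons ks k) 0)%E.
  move=> y0; rewrite /occupation_integral ge0_integralZl//.
  - have := occupation_nested k ks 0 y0; rewrite /occupation_integral /h => ->.
    by rewrite muleA -EFinM exprSr invfM mulrC.
  - exact: measurable_alive_dyadic.
  - by apply: measurable_funTS; apply: measurableT_comp => //; exact: (measurable_height hJ).
  - by move=> z al; rewrite h0// (alive_dyadic_ge0 hJ).
rewrite size_rcons -occE//.
apply: (@Gamma_a_occupation _ _ _ _ _ _ hJ _ g _ _ _ _ _ (\sum_(j <- rcons ks k) j.+1)%N) => //.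
- by move=> y y0; rewrite /g muleCA -IH.
- exact: measurable_funeM.
- by move=> y y0; rewrite /g mule_ge0 ?h0.
- move=> y z y0 yz; apply: lee_wpmul2l => //; apply: lee_pmul => //.
  + by rewrite lee_fin exprn_ge0.
  + exact: nested_sum_ge0.
  + by rewrite lee_fin lerXn2r// nnegrE (le_trans y0).
  + exact: nested_sum_le.
- move=> l /andP[l0 l1]; rewrite !occE ?mulr_gt0// muleCA; apply: lee_wpmul2l.
    by rewrite lee_fin invr_ge0 exprn_ge0// oppr_ge0 ltW.
  by apply: nested_sum_scale; rewrite ?add0n ?(ltW l0) ?(ltW l1) ?(ltW x0).
Qed.
End strings.

Theorem corollary3
  (d : measure_display) (Omega : measurableType d) (R : realType)
  (P : probability Omega R) (J : R -> {RV P >-> R})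
  (c sigma : R) (nu : {measure set R -> \bar R})
  (sigma_ge0 : 0 <= sigma)
  (nu_levy : (\int[nu]_(y in `]0%R, +oo[%classic) (Num.min 1 y)%:E < +oo)%E)
  (J_levy : subordinator_plus_brownian sigma J)
  (J_exponent : forall alpha : R, 0 <= alpha ->
    laplace_exponent J alpha =
      c * alpha - sigma ^+ 2 * alpha ^+ 2 / 2
      - \int[nu]_(y in `]0, +oo[%classic) (expR (- alpha * y) - 1))
  (J_integrable : P.-integrable setT (EFin \o J 1))
  (mean_drift_lt0 : mean_drift J < 0)
  (m : nat) (m_gt0 : (0 < m)%N) (k : m.-tuple nat) (x : R) (x_gt0 : 0 < x) :
  Gamma_a_string J (rev [seq power_fun i | i <- k]) x =
    (((- mean_drift J) ^- m)%:E * nested_sum (psi_coef J) x k 0)%E.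
Proof.
by rewrite (Gamma_a_string_nested_sum J_levy J_integrable mean_drift_lt0 k x_gt0) size_tuple.
Qed.
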